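(* Let $q\in\mathbb{C}^{\times}$ be not a root of unity, let $\ell\in\mathbb{C}$, and let $(W,Y_W)$ be a $\mathbb{Z}$-equivariant $\phi$-coordinated quasi $V_{\widehat{\mathfrak{D}}}(\ell,0)$-module (with respect to $\phi(x,z)=xe^{z}$ and the linear character $\chi_q:\mathbb{Z}\to\mathbb{C}^\times$, $\chi_q(m)=q^m$). Then $W$ is a restricted module of level $\ell$ for the $q$-Virasoro algebra $D$ with $$\hat{D}^{\alpha,r}(x)=Y_W(d^{\alpha,r},x)\quad\text{for all }\alpha,r\in\mathbb{Z},$$ where $\hat{D}^{\alpha,r}(x)=\hat{D}^{\alpha}(q^{r}x)$.
   Context: All vector spaces are over $\mathbb{C}$. **$q$-Virasoro algebra $D$.** For $n\in\mathbb{Z}$ and $p\in\mathbb{C}^\times$, $[n]_p=\frac{p^{-n}-p^{n}}{p^{-1}-p}$ with $[n]_{1}=n$. $D$ is the Lie algebra with generators $\mathbf{c}$ and $D^{\alpha}(n)$ ($\alpha,n\in\mathbb{Z}$), with $\mathbf{c}$ central, and relations $D^{-\alpha}(n)=-D^{\alpha}(n)$ and $$[D^{\alpha}(n),D^{\beta}(m)]=(q-q^{-1})[\alpha m-\beta n]_qD^{\alpha+\beta}(m+n)-(q-q^{-1})[\alpha m+\beta n]_qD^{\alpha-\beta}(m+n)+([m]_{q^{\alpha+\beta}}-[m]_{q^{\alpha-\beta}})\delta_{m+n,0}\mathbf{c}.$$ Set $D^{\alpha}(x)=\sum_{n\in\mathbb{Z}}D^{\alpha}(n)x^{-n-1}$,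 $\hat{D}^{0}(x)=xD^0(x)$ and $\hat{D}^{\alpha}(x)=xD^{\alpha}(x)-\frac{1}{q^{-\alpha}-q^{\alpha}}\mathbf{c}$ for $\alpha\neq0$. A $D$-module $W$ is *restricted* if for every $\alpha\in\mathbb{Z}$, $w\in W$, $D^{\alpha}(n)w=0$ for $n$ sufficiently large; it is *of level $\ell$* if $\mathbf{c}$ acts as the scalar $\ell$. **The Lie algebra $\mathfrak{D}$.** $\mathfrak{D}$ is the Lie algebra with generators $d^{\alpha,r}$ ($\alpha,r\in\mathbb{Z}$) and relations $d^{-\alpha,r}=-d^{\alpha,r}$ and $$[d^{\alpha,r},d^{\beta,s}]=\delta_{\alpha+\beta,s-r}d^{\alpha+\beta,-\alpha+s}-\delta_{\alpha+\beta,r-s}d^{\alpha+\beta,\alpha+s}-\delta_{\alpha-\beta,s-r}d^{\alpha-\beta,-\alpha+s}+\delta_{\alpha-\beta,r-s}d^{\alpha-\beta,\alpha+s}.$$ It has a symmetric invariant bilinear form $\langle d^{\alpha,r},d^{\beta,s}\rangle=\delta_{r,s}(\delta_{\alpha-\beta,0}-\delta_{\alpha+\beta,0})$. The affine Lie algebra is $\widehat{\mathfrak{D}}=\mathfrak{D}\otimes\mathbb{C}[t,t^{-1}]\oplus\mathbb{C}\mathbf{c}$ with $\mathbf{c}$ central and $[a\otimes t^m,b\otimes t^n]=[a,b]\otimes t^{m+n}+m\delta_{m+n,0}\langle a,b\rangle\mathbf{c}$. **The vertex algebra $V_{\widehat{\mathfrak{D}}}(\ell,0)$.** Its underlying space is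 $U(\widehat{\mathfrak{D}})\otimes_{U(\mathfrak{D}\otimes\mathbb{C}[t]+\mathbb{C}\mathbf{c})}\mathbb{C}_\ell$, where $\mathbb{C}_\ell=\mathbb{C}$ with $\mathfrak{D}\otimes\mathbb{C}[t]$ acting by $0$ and $\mathbf{c}$ by $\ell$. The vacuum vector is $\mathbf{1}=1\otimes1$; $a\in\mathfrak{D}$ is identified with $(a\otimes t^{-1})\mathbf{1}$; the vertex algebra structure is the unique one with $Y(a,x)=\sum_n(a\otimes t^n)x^{-n-1}$ for $a\in\mathfrak{D}$. For $m\in\mathbb{Z}$, $\sigma_m$ is the unique vertex algebra automorphism of $V_{\widehat{\mathfrak{D}}}(\ell,0)$ with $\sigma_m(d^{\alpha,r})=d^{\alpha,r+m}$; $\mathbb{Z}$ is regarded as an automorphism group of $V_{\widehat{\mathfrak{D}}}(\ell,0)$ by identifying $m$ with $\sigma_m$. **$\phi$-coordinated quasi modules.** For a vertex algebra $V$, a *$\phi$-coordinated quasi $V$-module* (with $\phi(x,z)=xe^z$) is a vector space $W$ with a linear map $Y_W(\cdot,x):V\to\mathrm{Hom}(W,W((x)))$ such that $Y_W(\mathbf{1},x)=1_W$ and for all $u,v\in V$ there is a nonzero polynomial $p(x)$ with $p(x_1/x_2)Y_W(u,x_1)Y_W(v,x_2)\in\mathrm{Hom}(W,W((x_1,x_2)))$ and $$p(e^z)Y_W(Y(u,z)v,x_2)=\big(p(x_1/x_2)Y_W(u,x_1)Y_W(v,x_2)\big)|_{x_1=x_2e^z}.$$ If $G$ is an automorphism group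 of $V$ with a linear character $\chi:G\to\mathbb{C}^\times$, such a module is *$G$-equivariant* if $Y_W(gv,x)=Y_W(v,\chi(g)x)$ for $g\in G$, $v\in V$, and for all $u,v\in V$ there is a (nonzero) $p(x)\in\mathbb{C}[x]$ with only zeroes in $\chi(G)$ such that $p(x_1/x_2)Y_W(u,x_1)Y_W(v,x_2)\in\mathrm{Hom}(W,W((x_1,x_2)))$. *)

(* Defs.v *)
From HB Require Import structures.
From mathcomp Require Import all_boot all_order all_algebra.
From mathcomp Require Import generic_quotient finmap complex.
From mathcomp Require Import boolp classical_sets functions cardinality.
From mathcomp Require Import fsbigop reals zify ring.
Set Implicit Arguments.
Unset Strict Implicit.
Unset Printing Implicit Defensive.
Import Order.TTheory GRing.Theory Num.Theory.
Local Open Scope ring_scope.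

HB.mixin Record isLieAlgebra (K : fieldType) L of GRing.Lmodule K L := {
  lie : L -> L -> L;
  lie_linearl : forall y : L, linear (lie^~ y);
  lie_linearr : forall x : L, linear (lie x);
  liexx : forall x : L, lie x x = 0;
  lie_jacobi : forall x y z : L,
    lie x (lie y z) + lie y (lie z x) + lie z (lie x y) = 0
}.

#[short(type="lieAlgType")]
HB.structure Definition LieAlgebra (K : fieldType) :=
  {L of GRing.Lmodule K L & isLieAlgebra K L}.

Record lie_module (K : fieldType) (L : lieAlgType K) (W : lmodType K) :=
  LieModule {
    lie_act :> L -> W -> W;
    lie_act_linearl : forall w, linear (lie_act^~ w);
    lie_act_linearr : forall x, linear (lie_act x);
    lie_act_lie : forall x y w, lie_act (lie x y) w =
      lie_act x (lie_act y w) - lie_act y (lie_act x w)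
  }.

Record inv_form (K : fieldType) (L : lieAlgType K) := InvForm {
  form :> L -> L -> K;
  form_linear : forall y, scalar (form^~ y);
  form_sym : forall x y, form x y = form y x;
  form_inv : forall x y z, form (lie x y) z = form x (lie y z)
}.

(** [pres rel] is the [K]-vector space generated by [X] with bilinear products
    indexed by [B], subject to the relations [rel].  With [B := void] it is a
    vector space given by generators and relations; with [B := unit] it is a
    (nonassociative) algebra given by generators and relations.  *)

Section Presentation.
Variables (K : fieldType) (B X : Type).

Inductive term :=
| Gen of X
| Zero
| Add of term & term
| Scale of K & term
| Op of B & term & term.

Definition Opp t := Scale (- 1) t.
Definition Sub s t := Add s (Opp t).

HB.instance Definition _ := gen_eqMixin term.
HB.instance Definition _ := gen_choiceMixin term.

Variable rel : term -> term -> Prop.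

Inductive cong : term -> term -> Prop :=
| cong_rel s t : rel s t -> cong s t
| cong_refl t : cong t t
| cong_sym s t : cong s t -> cong t s
| cong_trans s t u : cong s t -> cong t u -> cong s u
| cong_Add s s' t t' : cong s s' -> cong t t' -> cong (Add s t) (Add s' t')
| cong_Scale a t t' : cong t t' -> cong (Scale a t) (Scale a t')
| cong_Op b s s' t t' : cong s s' -> cong t t' -> cong (Op b s t) (Op b s' t')
| cong_AddA s t u : cong (Add s (Add t u)) (Add (Add s t) u)
| cong_AddC s t : cong (Add s t) (Add t s)
| cong_Add0 t : cong (Add Zero t) t
| cong_AddN t : cong (Add (Opp t) t) Zero
| cong_ScaleA a b t : cong (Scale a (Scale b t)) (Scale (a * b) t)
| cong_Scale1 t : cong (Scale 1 t) t
| cong_ScaleDr a s t :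
    cong (Scale a (Add s t)) (Add (Scale a s) (Scale a t))
| cong_ScaleDl a b t :
    cong (Scale (a + b) t) (Add (Scale a t) (Scale b t))
| cong_Opl b a s t u :
    cong (Op b (Add (Scale a s) t) u) (Add (Scale a (Op b s u)) (Op b t u))
| cong_Opr b a s t u :
    cong (Op b u (Add (Scale a s) t)) (Add (Scale a (Op b u s)) (Op b u t)).

Definition congb s t := `[< cong s t >].

Lemma congb_refl : reflexive congb.
Proof. by move=> t; apply/asboolP; exact: cong_refl. Qed.

Lemma congb_sym : symmetric congb.
Proof.
by move=> s t; apply/asboolP/asboolP; exact: cong_sym.
Qed.

Lemma congb_trans : transitive congb.
Proof.
move=> t s u /asboolP st /asboolP tu; apply/asboolP; exact: cong_trans st tu.
Qed.

Canonical cong_equiv := EquivRel congb congb_refl congb_sym congb_trans.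

Definition pres := {eq_quot cong_equiv}%qT.

HB.instance Definition _ := Choice.on pres.
HB.instance Definition _ := EqQuotient.on pres.

Definition pi_pres (t : term) : pres := \pi_({eq_quot cong_equiv}%qT)%qT t.
Definition repr_pres (x : pres) : term := repr x.

Lemma repr_presK x : pi_pres (repr_pres x) = x.
Proof. exact: reprK. Qed.

Lemma eq_pres s t : (pi_pres s = pi_pres t) <-> cong s t.
Proof.
split; first by move/eqquotP/asboolP.
by move=> st; apply/eqquotP/asboolP.
Qed.

Lemma cong_repr t : cong (repr_pres (pi_pres t)) t.
Proof. by apply/eq_pres; rewrite repr_presK. Qed.

Definition gen (x : X) : pres := pi_pres (Gen x).
Definition pres_zero : pres := pi_pres Zero.
Definition pres_add (x y : pres) := pi_pres (Add (repr_pres x) (repr_pres y)).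
Definition pres_scale a (x : pres) := pi_pres (Scale a (repr_pres x)).
Definition pres_op b (x y : pres) :=
  pi_pres (Op b (repr_pres x) (repr_pres y)).

Lemma pi_add s t : pi_pres (Add s t) = pres_add (pi_pres s) (pi_pres t).
Proof. by apply/eq_pres; apply: cong_Add; apply/cong_sym/cong_repr. Qed.

Lemma pi_scale a t : pi_pres (Scale a t) = pres_scale a (pi_pres t).
Proof. by apply/eq_pres; apply: cong_Scale; apply/cong_sym/cong_repr. Qed.

Lemma pi_op b s t : pi_pres (Op b s t) = pres_op b (pi_pres s) (pi_pres t).
Proof. by apply/eq_pres; apply: cong_Op; apply/cong_sym/cong_repr. Qed.

Let ind (P : pres -> Prop) : (forall t, P (pi_pres t)) -> forall x, P x.
Proof. by move=> Pt x; rewrite -[x]repr_presK. Qed.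

Lemma pres_addA : associative pres_add.
Proof.
elim/ind=> s; elim/ind=> t; elim/ind=> u; rewrite -!pi_add.
by apply/eq_pres; exact: cong_AddA.
Qed.

Lemma pres_addC : commutative pres_add.
Proof.
by elim/ind=> s; elim/ind=> t; rewrite -!pi_add; apply/eq_pres/cong_AddC.
Qed.

Lemma pres_add0 : left_id pres_zero pres_add.
Proof. by elim/ind=> t; rewrite -pi_add; apply/eq_pres/cong_Add0. Qed.

Lemma pres_addN : left_inverse pres_zero (pres_scale (- 1)) pres_add.
Proof. by elim/ind=> t; rewrite -pi_scale -pi_add; apply/eq_pres/cong_AddN. Qed.

HB.instance Definition _ :=
  GRing.isZmodule.Build pres pres_addA pres_addC pres_add0 pres_addN.

Lemma pres_scaleA a b x : pres_scale a (pres_scale b x) = pres_scale (a * b) x.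
Proof. by elim/ind: x => t; rewrite -!pi_scale; apply/eq_pres/cong_ScaleA. Qed.

Lemma pres_scale1 : left_id 1 pres_scale.
Proof. by elim/ind=> t; rewrite -pi_scale; apply/eq_pres/cong_Scale1. Qed.

Lemma pres_scaleDr : right_distributive pres_scale +%R.
Proof.
move=> a; elim/ind=> s; elim/ind=> t.
rewrite /GRing.add /= -!(pi_scale, pi_add).
by apply/eq_pres/cong_ScaleDr.
Qed.

Lemma pres_scaleDl x : {morph pres_scale^~ x : a b / a + b >-> a + b}.
Proof.
move=> a b; elim/ind: x => t.
by rewrite {2}/GRing.add /= -!(pi_scale, pi_add); apply/eq_pres/cong_ScaleDl.
Qed.

HB.instance Definition _ := GRing.Zmodule_isLmodule.Build K pres
  pres_scaleA pres_scale1 pres_scaleDr pres_scaleDl.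

Lemma piD s t : pi_pres (Add s t) = pi_pres s + pi_pres t.
Proof. exact: pi_add. Qed.

Lemma piZ a t : pi_pres (Scale a t) = a *: pi_pres t.
Proof. exact: pi_scale. Qed.

Lemma pi0 : pi_pres Zero = 0.
Proof. by []. Qed.

Lemma piN t : pi_pres (Opp t) = - pi_pres t.
Proof. by rewrite piZ scaleN1r. Qed.

Lemma piB s t : pi_pres (Sub s t) = pi_pres s - pi_pres t.
Proof. by rewrite piD piN. Qed.

Lemma pres_op_linearl b y : linear ((pres_op b)^~ y).
Proof.
move=> a; elim/ind: y => u; elim/ind=> s; elim/ind=> t /=.
by rewrite -piZ -piD -!pi_op -piZ -piD; apply/eq_pres/cong_Opl.
Qed.

Lemma pres_op_linearr b x : linear (pres_op b x).
Proof.
move=> a; elim/ind: x => u; elim/ind=> s; elim/ind=> t.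
by rewrite -piZ -piD -!pi_op -piZ -piD; apply/eq_pres/cong_Opr.
Qed.

Lemma pres_rel s t : rel s t -> pi_pres s = pi_pres t.
Proof. by move=> st; apply/eq_pres/cong_rel. Qed.

Lemma pres_ind (P : pres -> Prop) :
    (forall x, P (gen x)) -> P 0 -> (forall x y, P x -> P y -> P (x + y)) ->
    (forall a x, P x -> P (a *: x)) ->
    (forall b x y, P x -> P y -> P (pres_op b x y)) ->
  forall x, P x.
Proof.
move=> Pg P0 PD PZ PO; elim/ind; elim=> //=.
- by move=> s Ps t Pt; rewrite piD; exact: PD.
- by move=> a t Pt; rewrite piZ; exact: PZ.
- by move=> b s Ps t Pt; rewrite pi_op; exact: PO.
Qed.

Section Lift.
Variables (T : lmodType K) (op : B -> T -> T -> T) (f : X -> T).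

Fixpoint eval (t : term) : T :=
  match t with
  | Gen x => f x
  | Zero => 0
  | Add s t => eval s + eval t
  | Scale a t => a *: eval t
  | Op b s t => op b (eval s) (eval t)
  end.

Hypothesis op_linearl : forall b y, linear ((op b)^~ y).
Hypothesis op_linearr : forall b x, linear (op b x).
Hypothesis eval_rel : forall s t, rel s t -> eval s = eval t.

Definition lift (x : pres) : T := eval (repr_pres x).

Lemma eval_cong s t : cong s t -> eval s = eval t.
Proof.
elim=> //= {s t}.
- by move=> s t u _ -> _ ->.
- by move=> s s' t t' _ -> _ ->.
- by move=> a t t' _ ->.
- by move=> b s s' t t' _ -> _ ->.
- by move=> s t u; rewrite addrA.
- by move=> s t; rewrite addrC.
- by move=> t; rewrite add0r.
- by move=> t; rewrite scaleN1r addNr.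
- by move=> a b t; rewrite scalerA.
- by move=> t; rewrite scale1r.
- by move=> a s t; rewrite scalerDr.
- by move=> a b t; rewrite scalerDl.
- by move=> b a s t u; rewrite op_linearl.
- by move=> b a s t u; rewrite op_linearr.
Qed.

Lemma lift_pi t : lift (pi_pres t) = eval t.
Proof. exact/eval_cong/cong_repr. Qed.

Lemma lift_linear : linear lift.
Proof.
move=> a; elim/ind=> s; elim/ind=> t.
by rewrite -piZ -piD !lift_pi.
Qed.

Lemma lift_op b x y : lift (pres_op b x y) = op b (lift x) (lift y).
Proof. by elim/ind: x => s; elim/ind: y => t; rewrite -pi_op !lift_pi. Qed.

Lemma lift_gen x : lift (gen x) = f x.
Proof. exact: lift_pi. Qed.

End Lift.
End Presentation.

Arguments Zero {K B X}.
Arguments Gen {K B X}.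
Arguments gen {K B X rel}.

Section LiePresentation.
Variables (K : fieldType) (X : Type).
Notation term := (term K unit X).
Definition Lie (s t : term) : term := Op tt s t.
Variable rel : term -> term -> Prop.

Inductive lie_rel : term -> term -> Prop :=
| lie_rel_base s t : rel s t -> lie_rel s t
| lie_rel_alt t : lie_rel (Lie t t) Zero
| lie_rel_jacobi s t u :
    lie_rel (Add (Add (Lie s (Lie t u)) (Lie t (Lie u s))) (Lie u (Lie s t)))
            Zero.

Definition lie_pres := pres lie_rel.
HB.instance Definition _ := GRing.Lmodule.on lie_pres.

Definition lie_pres_lie (x y : lie_pres) : lie_pres := pres_op tt x y.

Lemma lie_pres_xx (x : lie_pres) : lie_pres_lie x x = 0.
Proof.
have := pres_rel (lie_rel_alt (repr_pres x)).
by rewrite pi_op pi0 !repr_presK.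
Qed.

Lemma lie_pres_jacobi (x y z : lie_pres) :
  lie_pres_lie x (lie_pres_lie y z) + lie_pres_lie y (lie_pres_lie z x)
  + lie_pres_lie z (lie_pres_lie x y) = 0.
Proof.
have := pres_rel (lie_rel_jacobi (repr_pres x) (repr_pres y) (repr_pres z)).
by rewrite !piD !pi_op pi0 !repr_presK.
Qed.

HB.instance Definition _ := isLieAlgebra.Build K lie_pres
  (@pres_op_linearl K unit X lie_rel tt) (@pres_op_linearr K unit X lie_rel tt)
  lie_pres_xx lie_pres_jacobi.

End LiePresentation.

(** Universal enveloping algebra: unital associative algebra generated by the vector space [L] (the
    generator [None] is the unit), subject to [x y - y x = [x, y]].  *)

Section Enveloping.
Variables (K : fieldType) (L : lieAlgType K).
Notation term := (term K unit (option L)).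
Notation "s ** t" := (Op tt s t : term) (at level 40).

Inductive env_rel : term -> term -> Prop :=
| env_assoc s t u : env_rel (s ** (t ** u)) ((s ** t) ** u)
| env_1l t : env_rel (Gen None ** t) t
| env_1r t : env_rel (t ** Gen None) t
| env_linear a x y : env_rel (Gen (Some (a *: x + y)))
                             (Add (Scale a (Gen (Some x))) (Gen (Some y)))
| env_lie x y : env_rel (Gen (Some (lie x y)))
    (Sub (Gen (Some x) ** Gen (Some y)) (Gen (Some y) ** Gen (Some x))).

Definition envelope := pres env_rel.
HB.instance Definition _ := GRing.Lmodule.on envelope.

Definition env_one : envelope := gen None.
Definition env_mul (x y : envelope) : envelope := pres_op tt x y.
Definition env_inj (x : L) : envelope := gen (Some x).

Lemma env_mulA : associative env_mul.
Proof.
move=> x y z.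
have := pres_rel (env_assoc (repr_pres x) (repr_pres y) (repr_pres z)).
by rewrite !pi_op !repr_presK.
Qed.

Lemma env_mul1l : left_id env_one env_mul.
Proof.
by move=> x; have := pres_rel (env_1l (repr_pres x)); rewrite pi_op repr_presK.
Qed.

Lemma env_mul1r : right_id env_one env_mul.
Proof.
by move=> x; have := pres_rel (env_1r (repr_pres x)); rewrite pi_op repr_presK.
Qed.

Lemma env_mulDl : left_distributive env_mul +%R.
Proof.
move=> x y z; have := pres_op_linearl tt z 1 x y.
by rewrite !scale1r.
Qed.

Lemma env_mulDr : right_distributive env_mul +%R.
Proof.
move=> x y z; have := pres_op_linearr tt x 1 y z.
by rewrite !scale1r.
Qed.

HB.instance Definition _ := GRing.Zmodule_isPzRing.Build envelope
  env_mulA env_mul1l env_mul1r env_mulDl env_mulDr.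

Lemma env_1_neq0 : 1 != 0 :> envelope.
Proof.
pose f (x : option L) : K^o := if x is None then 1 else 0.
pose op (_ : unit) (x y : K^o) : K^o := x * y.
have opl b y : linear ((op b)^~ y).
  by move=> a x z; rewrite /op mulrDl scalerAl.
have opr b x : linear (op b x).
  by move=> a y z; rewrite /op mulrDr scalerAr.
have oprel s t : env_rel s t -> eval op f s = eval op f t.
  case=> {s t} /=.
  - by move=> s t u; rewrite /op mulrA.
  - by move=> t; rewrite /op mul1r.
  - by move=> t; rewrite /op mulr1.
  - by move=> a x y; rewrite scaler0 addr0.
  - by move=> x y; rewrite /op mul0r scaler0 addr0.
apply/eqP => /(congr1 (lift op f)).
have /= -> : lift op f env_one = 1 by exact: (lift_gen opl opr oprel).
have -> : lift op f (0 : envelope) = 0 by exact: (lift_pi opl opr oprel Zero).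
by move/eqP; rewrite oner_eq0.
Qed.

HB.instance Definition _ :=
  GRing.PzSemiRing_isNonZero.Build envelope env_1_neq0.

Lemma env_scaleAl (a : K) (x y : envelope) : a *: (x * y) = (a *: x) * y.
Proof.
have := pres_op_linearl tt y a x 0; rewrite -/env_mul !addr0 => /= e.
rewrite [RHS]e -[LHS]addr0; congr (_ + _).
by have := pres_op_linearl tt y (- 1) 0 0; rewrite !scaleN1r oppr0 addr0 addNr.
Qed.

Lemma env_scaleAr (a : K) (x y : envelope) : a *: (x * y) = x * (a *: y).
Proof.
have := pres_op_linearr tt x a y 0; rewrite -/env_mul !addr0 => /= e.
rewrite [RHS]e -[LHS]addr0; congr (_ + _).
by have := pres_op_linearr tt x (- 1) 0 0; rewrite !scaleN1r oppr0 addr0 addNr.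
Qed.

HB.instance Definition _ :=
  GRing.Lmodule_isLalgebra.Build K envelope env_scaleAl.
HB.instance Definition _ :=
  GRing.Lalgebra_isAlgebra.Build K envelope env_scaleAr.

Lemma env_inj_linear : linear env_inj.
Proof.
by move=> a x y; have := pres_rel (env_linear a x y); rewrite piD piZ.
Qed.

Lemma env_inj_lie x y :
  env_inj (lie x y) = env_inj x * env_inj y - env_inj y * env_inj x.
Proof.
by have := pres_rel (env_lie x y); rewrite piB !pi_op.
Qed.

End Enveloping.

(** The induced module [U(L) (x)_{U(p)} M] for a subalgebra [p] of [L] and a [p]-module [M] with
    action [act] (whose values matter on [p] only).  As [p] generates [U(p)],
    a tensor product balanced over [p] is balanced over [U(p)].  *)

Section Induced.
Variables (K : fieldType) (L : lieAlgType K) (p : set L).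
Variables (M : lmodType K) (act : L -> M -> M).
Notation term := (term K void (envelope L * M)).

Inductive ind_rel : term -> term -> Prop :=
| ind_linearl a u v m : ind_rel (Gen (a *: u + v, m))
                                (Add (Scale a (Gen (u, m))) (Gen (v, m)))
| ind_linearr a u m n : ind_rel (Gen (u, a *: m + n))
                                (Add (Scale a (Gen (u, m))) (Gen (u, n)))
| ind_balanced u x m : p x ->
    ind_rel (Gen (u * env_inj x, m)) (Gen (u, act x m)).

Definition induced := pres ind_rel.
HB.instance Definition _ := GRing.Lmodule.on induced.

Definition tensor (u : envelope L) (m : M) : induced := gen (u, m).

Lemma tensor_linearl m : linear (tensor^~ m).
Proof.
by move=> a u v; have := pres_rel (ind_linearl a u v m); rewrite piD piZ.
Qed.

Lemma tensor_linearr u : linear (tensor u).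
Proof.
by move=> a m n; have := pres_rel (ind_linearr a u m n); rewrite piD piZ.
Qed.

Lemma tensor_balanced u x m : p x -> tensor (u * env_inj x) m = tensor u (act x m).
Proof. by move=> px; apply/pres_rel/ind_balanced. Qed.

Let noop (b : void) : induced -> induced -> induced := match b with end.

Definition ind_act (x : L) : induced -> induced :=
  lift noop (fun um => tensor (env_inj x * um.1) um.2).

Fact noop_linearl b y : linear ((noop b)^~ y). Proof. by case: b. Qed.
Fact noop_linearr b x : linear (noop b x). Proof. by case: b. Qed.

Fact ind_act_rel (x : L) s t : ind_rel s t ->
  eval noop (fun um => tensor (env_inj x * um.1) um.2) s =
  eval noop (fun um => tensor (env_inj x * um.1) um.2) t.
Proof.
case=> {s t} /=.
- by move=> a u v m; rewrite mulrDr -scalerAr tensor_linearl.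
- by move=> a u m n; rewrite tensor_linearr.
- by move=> u y m py; rewrite mulrA tensor_balanced.
Qed.

Lemma ind_act_tensor x u m : ind_act x (tensor u m) = tensor (env_inj x * u) m.
Proof. exact: (lift_gen noop_linearl noop_linearr (@ind_act_rel x)). Qed.

Lemma ind_act_linearr x : linear (ind_act x).
Proof. exact: (lift_linear noop_linearl noop_linearr (@ind_act_rel x)). Qed.

Lemma induced_ind (P : induced -> Prop) :
    (forall u m, P (tensor u m)) -> P 0 ->
    (forall v w, P v -> P w -> P (v + w)) -> (forall a v, P v -> P (a *: v)) ->
  forall v, P v.
Proof. by move=> Pt P0 PD PZ; apply: pres_ind => // -[]. Qed.

Lemma ind_act0 x : ind_act x 0 = 0.
Proof.
have := ind_act_linearr x (- 1) 0 0.
by rewrite scaler0 addr0 scaleN1r addNr.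
Qed.

Lemma ind_actD x v w : ind_act x (v + w) = ind_act x v + ind_act x w.
Proof. by have := ind_act_linearr x 1 v w; rewrite !scale1r. Qed.

Lemma ind_actZ x a v : ind_act x (a *: v) = a *: ind_act x v.
Proof. by have := ind_act_linearr x a v 0; rewrite ind_act0 !addr0. Qed.

Lemma ind_act_linearl v : linear (ind_act^~ v).
Proof.
move=> a x y /=; elim/induced_ind: v.
- move=> u m; rewrite !ind_act_tensor env_inj_linear mulrDl -scalerAl.
  by rewrite tensor_linearl.
- by rewrite !ind_act0 scaler0 addr0.
- by move=> v w ev ew; rewrite !ind_actD ev ew scalerDr addrACA.
- by move=> b v ev; rewrite !ind_actZ ev scalerDr !scalerA mulrC.
Qed.

Lemma ind_act_lie x y v :
  ind_act (lie x y) v = ind_act x (ind_act y v) - ind_act y (ind_act x v).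
Proof.
elim/induced_ind: v.
- move=> u m; rewrite !ind_act_tensor env_inj_lie mulrBl !mulrA.
  have := tensor_linearl m (- 1) (env_inj y * env_inj x * u)
                         (env_inj x * env_inj y * u).
  by rewrite !scaleN1r => e; rewrite [in LHS]addrC e [in LHS]addrC.
- by rewrite !ind_act0 subr0.
- by move=> v w ev ew; rewrite !ind_actD ev ew opprD addrACA.
- by move=> a v ev; rewrite !ind_actZ ev scalerBr.
Qed.

Definition ind_module : lie_module L induced :=
  LieModule ind_act_linearl ind_act_linearr ind_act_lie.

End Induced.

(** [fsupp X M] is the direct sum of copies of [M] indexed by [X].  *)

Section FiniteSupport.
Variables (K : fieldType) (X : choiceType) (M : lmodType K).

Definition fsupp_pred : {pred X -> M} :=
  fun f => `[< finite_set (f @^-1` [set~ 0])%classic >].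

Lemma fsupp_predP (f : X -> M) :
  f \in fsupp_pred <-> exists A : {fset X}, forall x, x \notin A -> f x = 0.
Proof.
split=> [/asboolP/finite_fsetP[A fA]|[A fA]].
  exists A => x xA; apply: contrapT => fx0; move/negP: xA; apply.
  have : [set` A]%classic x by rewrite -fA.
  by [].
by apply/asboolP/(finite_subfset A) => x /=; apply: contra_notT => /fA.
Qed.

Lemma fsupp_submod : subsemimod_closed fsupp_pred.
Proof.
split.
  split; first by apply/fsupp_predP; exists fset0.
  move=> f g /fsupp_predP[A fA] /fsupp_predP[B gB].
  apply/fsupp_predP; exists (A `|` B)%fset => x.
  by rewrite inE negb_or => /andP[/fA fx /gB gx]; rewrite fctE fx gx addr0.
move=> a f /fsupp_predP[A fA]; apply/fsupp_predP; exists A => x /fA fx.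
by rewrite /GRing.scale /= fx scaler0.
Qed.

Record fsupp := Fsupp {fsupp_fun :> X -> M; _ : fsupp_fun \in fsupp_pred}.
HB.instance Definition _ := [isSub for fsupp_fun].
HB.instance Definition _ := [Choice of fsupp by <:].
HB.instance Definition _ :=
  GRing.SubChoice_isSubLmodule.Build K (X -> M) fsupp_pred fsupp fsupp_submod.

Definition mono_fun (i : X) (a : M) : X -> M := fun j => if j == i then a else 0.

Fact mono_subproof i a : mono_fun i a \in fsupp_pred.
Proof.
apply/fsupp_predP; exists [fset i]%fset => x.
by rewrite inE /mono_fun => /negPf ->.
Qed.

Definition mono i a : fsupp := Fsupp (mono_subproof i a).

Lemma fsuppP (f : fsupp) : exists A : {fset X}, forall x, x \notin A -> f x = 0.
Proof. by apply/fsupp_predP; exact: (valP f). Qed.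

Lemma fsupp_eq (f g : fsupp) : (forall x, f x = g x) -> f = g.
Proof. by move=> fg; apply/val_inj/funext. Qed.

Lemma fsuppD (f g : fsupp) x : (f + g) x = f x + g x. Proof. by []. Qed.
Lemma fsuppZ a (f : fsupp) x : (a *: f) x = a *: f x. Proof. by []. Qed.
Lemma fsupp0 x : (0 : fsupp) x = 0. Proof. by []. Qed.
Lemma monoE i a j : mono i a j = if j == i then a else 0. Proof. by []. Qed.

Lemma mono_linear i : linear (mono i).
Proof.
move=> c a b; apply: fsupp_eq => j; rewrite fsuppD fsuppZ !monoE.
by case: ifP => // _; rewrite scaler0 addr0.
Qed.

Lemma fsupp_sum I (r : seq I) (F : I -> fsupp) x :
  (\sum_(i <- r) F i) x = \sum_(i <- r) F i x.
Proof. by elim/big_ind2: _ => // f a g b <- <-. Qed.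

Lemma fsupp_ind (P : fsupp -> Prop) :
    (forall i a, P (mono i a)) -> (forall f g, P f -> P g -> P (f + g)) ->
  P 0 -> forall f, P f.
Proof.
move=> Pm PD P0 f; have [A fA] := fsuppP f.
have -> : f = \sum_(i <- A) mono i (f i).
  apply: fsupp_eq => x; rewrite fsupp_sum.
  have [xA|xA] := boolP (x \in A).
    rewrite (big_fsetD1 x) // monoE eqxx big_seq big1 /= ?addr0 // => i.
    by rewrite !inE /= /mono_fun eq_sym => /andP[/negPf ->].
  rewrite fA // big_seq big1 // => i iA; rewrite monoE; case: eqP => // xi.
  by rewrite xi iA in xA.
by elim/big_ind: _.
Qed.

End FiniteSupport.

(** The bilinear map with [(mono i a, mono j b) |-> phi i j a b].  *)

Section BilinearExtension.
Variables (K : fieldType) (X Y : choiceType) (M M' N : lmodType K).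
Variable phi : X -> Y -> M -> M' -> N.

Definition ext2 (f : fsupp X M) (g : fsupp Y M') : N :=
  \sum_(i \in [set: X]) \sum_(j \in [set: Y]) phi i j (f i) (g j).

Hypothesis phi_linearl : forall i j b, linear ((phi i j)^~ b).
Hypothesis phi_linearr : forall i j a, linear (phi i j a).

Let phi0l i j b : phi i j 0 b = 0.
Proof.
have := phi_linearl i j b (- 1) 0 0.
by rewrite scaler0 addr0 scaleN1r addNr.
Qed.

Let phi0r i j a : phi i j a 0 = 0.
Proof.
have := phi_linearr i j a (- 1) 0 0.
by rewrite scaler0 addr0 scaleN1r addNr.
Qed.

Lemma ext2E (A : {fset X}) (B : {fset Y}) (f : fsupp X M) (g : fsupp Y M') :
    (forall x, x \notin A -> f x = 0) -> (forall y, y \notin B -> g y = 0) ->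
  ext2 f g = \sum_(i <- A) \sum_(j <- B) phi i j (f i) (g j).
Proof.
move=> fA gB; rewrite /ext2 (fsbigTE A) => [|i /fA fi].
  by apply: eq_bigr => i _; rewrite (fsbigTE B) // => j /gB ->; rewrite phi0r.
by rewrite fsbig1 // => j _; rewrite fi phi0l.
Qed.

Lemma ext2_linearl g : linear (ext2^~ g).
Proof.
move=> a f f'; have [B gB] := fsuppP g.
have [A fA] := fsuppP f; have [A' fA'] := fsuppP f'.
have sub C D (h : fsupp X M) : (forall x, x \notin C -> h x = 0) ->
    (forall x, x \notin (C `|` D)%fset -> h x = 0) /\
    (forall x, x \notin (D `|` C)%fset -> h x = 0).
  by move=> hC; split=> x; rewrite inE negb_or => /andP[]; eauto.
have [hA _] := sub A A' f fA; have [_ hA'] := sub A' A f' fA'.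
rewrite /= !(@ext2E (A `|` A')%fset B) //.
  rewrite scaler_sumr -big_split /=; apply: eq_bigr => i _.
  rewrite scaler_sumr -big_split /=; apply: eq_bigr => j _.
  exact: phi_linearl.
move=> x; rewrite inE negb_or => /andP[/fA fx /fA' fx'].
by rewrite -[LHS]/(a *: f x + f' x) fx fx' scaler0 addr0.
Qed.

Lemma ext2_linearr f : linear (ext2 f).
Proof.
move=> a g g'; have [A fA] := fsuppP f.
have [B gB] := fsuppP g; have [B' gB'] := fsuppP g'.
have sub C D (h : fsupp Y M') : (forall x, x \notin C -> h x = 0) ->
    (forall x, x \notin (C `|` D)%fset -> h x = 0) /\
    (forall x, x \notin (D `|` C)%fset -> h x = 0).
  by move=> hC; split=> x; rewrite inE negb_or => /andP[]; eauto.
have [hB _] := sub B B' g gB; have [_ hB'] := sub B' B g' gB'.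
rewrite /= !(@ext2E A (B `|` B')%fset) //.
  rewrite scaler_sumr -big_split /=; apply: eq_bigr => i _.
  rewrite scaler_sumr -big_split /=; apply: eq_bigr => j _.
  exact: phi_linearr.
move=> x; rewrite inE negb_or => /andP[/gB gx /gB' gx'].
by rewrite -[LHS]/(a *: g x + g' x) gx gx' scaler0 addr0.
Qed.

Lemma ext2_mono i j a b : ext2 (mono i a) (mono j b) = phi i j a b.
Proof.
rewrite (@ext2E [fset i]%fset [fset j]%fset).
- by rewrite !big_seq_fset1 !monoE !eqxx.
- by move=> x; rewrite inE monoE => /negPf ->.
- by move=> x; rewrite inE monoE => /negPf ->.
Qed.

Lemma ext2Dl f f' g : ext2 (f + f') g = ext2 f g + ext2 f' g.
Proof. by have := ext2_linearl g 1 f f'; rewrite !scale1r. Qed.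

Lemma ext2Dr f g g' : ext2 f (g + g') = ext2 f g + ext2 f g'.
Proof. by have := ext2_linearr f 1 g g'; rewrite !scale1r. Qed.

Lemma ext20l g : ext2 0 g = 0.
Proof.
have := ext2_linearl g (- 1) 0 0.
by rewrite /= scaler0 addr0 scaleN1r addNr.
Qed.

Lemma ext20r f : ext2 f 0 = 0.
Proof.
have := ext2_linearr f (- 1) 0 0.
by rewrite /= scaler0 addr0 scaleN1r addNr.
Qed.

End BilinearExtension.

Section LieTheory.
Variables (K : fieldType) (L : lieAlgType K).
Implicit Types x y z : L.

Lemma lieDl x y z : lie (x + y) z = lie x z + lie y z.
Proof. by have := lie_linearl z 1 x y; rewrite !scale1r. Qed.

Lemma lieDr x y z : lie x (y + z) = lie x y + lie x z.
Proof. by have := lie_linearr x 1 y z; rewrite !scale1r. Qed.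

Lemma lieC x y : lie x y = - lie y x.
Proof.
have := liexx (x + y); rewrite lieDl !lieDr !liexx add0r addr0.
by move/eqP; rewrite addr_eq0 => /eqP.
Qed.

End LieTheory.

Section Affine.
Variables (K : fieldType) (L : lieAlgType K) (F : inv_form L).

(** [(f, a)] stands for [sum_m f m (x) t^m + a c].  *)
Definition affine of inv_form L := (fsupp int L * K^o)%type.
Local Notation hatL := (affine F).
HB.instance Definition _ := GRing.Lmodule.on hatL.

(** [loop a m] is [a (x) t^m].  *)
Definition loop (a : L) (m : int) : hatL := (mono m a, 0).
Definition central : hatL := (0, 1).

Definition loop_lie (m n : int) (a b : L) : hatL :=
  (mono (m + n) (lie a b), if m + n == 0 then m%:~R * F a b else 0).

Definition affine_lie (x y : hatL) : hatL := ext2 loop_lie x.1 y.1.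

Lemma formDl x y z : F (x + y) z = F x z + F y z.
Proof. by have := form_linear F z 1 x y; rewrite scale1r mul1r. Qed.

Lemma formZl a x z : F (a *: x) z = a * F x z.
Proof.
have F0 : F 0 z = 0.
  by have /= := form_linear F z (- 1) 0 0; rewrite scaler0 addr0 mulN1r addNr.
by have /= := form_linear F z a x 0; rewrite F0 !addr0.
Qed.

Lemma loop_lie_linearl m n b : linear ((loop_lie m n)^~ b).
Proof.
move=> a x y; congr pair => /=; first by rewrite lie_linearl mono_linear.
case: ifP => _; last by rewrite scaler0 addr0.
by rewrite formDl formZl mulrDr mulrCA.
Qed.

Lemma loop_lie_linearr m n b : linear (loop_lie m n b).
Proof.
move=> a x y; congr pair => /=; first by rewrite lie_linearr mono_linear.
case: ifP => _; last by rewrite scaler0 addr0.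
by rewrite form_sym formDl formZl mulrDr mulrCA ![F _ b]form_sym.
Qed.

Lemma affine_lie_linearl y : linear (affine_lie^~ y).
Proof.
by move=> a x x'; exact: ext2_linearl loop_lie_linearl loop_lie_linearr _ _ _ _.
Qed.

Lemma affine_lie_linearr x : linear (affine_lie x).
Proof.
by move=> a y y'; exact: ext2_linearr loop_lie_linearl loop_lie_linearr _ _ _ _.
Qed.

Lemma affine_lie_loop a b m n :
  affine_lie (loop a m) (loop b n) = loop_lie m n a b.
Proof. exact: ext2_mono loop_lie_linearl loop_lie_linearr _ _ _ _. Qed.

Lemma affine_lie_centrall y : affine_lie central y = 0.
Proof. exact: ext20l loop_lie_linearl loop_lie_linearr _. Qed.

Lemma affine_lie_centralr x : affine_lie x central = 0.
Proof. exact: ext20r loop_lie_linearl loop_lie_linearr _. Qed.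

Lemma affine_ind (P : hatL -> Prop) :
    (forall a m, P (loop a m)) -> (forall c, P (c *: central)) ->
    (forall x y, P x -> P y -> P (x + y)) ->
  forall x, P x.
Proof.
move=> Pl Pc PD [f c].
have -> : (f, c) = (f, 0) + c *: central :> hatL.
  congr pair => /=; first by rewrite scaler0 addr0.
  by rewrite add0r; exact: (esym (mulr1 c)).
apply: (PD) => //; elim/fsupp_ind: f => [i a|f g Pf Pg|]; first exact: Pl.
- have -> : (f + g, 0) = (f, 0) + (g, 0) :> hatL by congr pair; rewrite /= addr0.
  exact: PD.
- by have -> : (0, 0) = 0 *: central :> hatL by rewrite scale0r.
Qed.

Lemma affine_lieDl x y z : affine_lie (x + y) z = affine_lie x z + affine_lie y z.
Proof. by have := affine_lie_linearl z 1 x y; rewrite !scale1r. Qed.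

Lemma affine_lieDr x y z : affine_lie x (y + z) = affine_lie x y + affine_lie x z.
Proof. by have := affine_lie_linearr x 1 y z; rewrite !scale1r. Qed.

Lemma affine_lie_centralZl c y : affine_lie (c *: central) y = 0.
Proof.
have := affine_lie_linearl y c central 0; rewrite /= !affine_lie_centrall.
rewrite !addr0 => ->; rewrite scaler0 add0r.
exact: ext20l loop_lie_linearl loop_lie_linearr _.
Qed.

Lemma affine_lie_centralZr c x : affine_lie x (c *: central) = 0.
Proof.
have := affine_lie_linearr x c central 0; rewrite /= !affine_lie_centralr.
rewrite !addr0 => ->; rewrite scaler0 add0r.
exact: ext20r loop_lie_linearl loop_lie_linearr _.
Qed.

Lemma form0 y : F 0 y = 0.
Proof. by have := formZl 0 0 y; rewrite scaler0 mul0r. Qed.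

Lemma formNl x y : F (- x) y = - F x y.
Proof. by rewrite -scaleN1r formZl mulN1r. Qed.

Lemma mono_opp (m : int) (a : L) : mono m (- a) = - mono m a.
Proof.
apply: fsupp_eq => i; rewrite -[RHS]/(- (mono m a i)) !monoE.
by case: ifP => _; rewrite ?oppr0.
Qed.

Lemma affine_lieC x y : affine_lie x y = - affine_lie y x.
Proof.
elim/affine_ind: x y => [a m|c|x x' ex ex'] y.
- elim/affine_ind: y => [b n|c|y y' ey ey'].
  + rewrite !affine_lie_loop /loop_lie; congr pair => /=.
      by rewrite lieC mono_opp addrC.
    rewrite [n + m]addrC; case: eqP => [mn|_]; last by rewrite oppr0.
    have -> : n = - m by apply/eqP; rewrite -addr_eq0 addrC mn.
    by rewrite mulrNz mulNr opprK form_sym.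
  + by rewrite affine_lie_centralZr affine_lie_centralZl oppr0.
  + by rewrite affine_lieDr affine_lieDl ey ey' opprD.
- by rewrite affine_lie_centralZr affine_lie_centralZl oppr0.
- by rewrite affine_lieDr affine_lieDl ex ex' opprD.
Qed.

Lemma affine_liexx x : affine_lie x x = 0.
Proof.
elim/affine_ind: x => [a m|c|x y ex ey].
- rewrite affine_lie_loop /loop_lie liexx; congr pair => /=.
    by apply: fsupp_eq => i; rewrite monoE; case: ifP.
  case: eqP => // /eqP; rewrite -mulr2n mulrn_eq0 /= => /eqP ->.
  by rewrite mulr0z mul0r.
- by rewrite affine_lie_centralZr.
- by rewrite affine_lieDl !affine_lieDr ex ey add0r addr0 affine_lieC addNr.
Qed.

Lemma affine_lie_loop_lie m n k a b c :
  affine_lie (loop a m) (loop_lie n k b c) = loop_lie m (n + k) a (lie b c).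
Proof.
rewrite -[RHS]affine_lie_loop.
have -> : loop_lie n k b c =
    loop (lie b c) (n + k) + (loop_lie n k b c).2 *: central.
  congr pair => /=; first by rewrite scaler0 addr0.
  by rewrite add0r; exact: (esym (mulr1 _)).
by rewrite affine_lieDr affine_lie_centralZr addr0.
Qed.

Lemma affine_lie_jacobi x y z :
  affine_lie x (affine_lie y z) + affine_lie y (affine_lie z x)
  + affine_lie z (affine_lie x y) = 0.
Proof.
have z0 u : affine_lie u 0 = 0.
  by have := affine_lie_centralZr 0 u; rewrite scale0r.
elim/affine_ind: x y z => [a m|s|x x' ex ex'] y z; last first.
- rewrite !(affine_lieDl, affine_lieDr) -[RHS]addr0 -{1}(ex y z) -(ex' y z).
  by rewrite addrACA [in LHS]addrACA [in RHS]addrACA [X in _ = X + _]addrACA.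
- by rewrite !(affine_lie_centralZl, affine_lie_centralZr, z0) !addr0.
elim/affine_ind: y z => [b n|s|y y' ey ey'] z; last first.
- rewrite !(affine_lieDl, affine_lieDr) -[RHS]addr0 -{1}(ey z) -(ey' z).
  by rewrite addrACA [in LHS]addrACA [in RHS]addrACA [X in _ = X + _]addrACA.
- by rewrite !(affine_lie_centralZl, affine_lie_centralZr, z0) !addr0.
elim/affine_ind: z => [c k|s|z z' ez ez']; last first.
- rewrite !(affine_lieDl, affine_lieDr) -[RHS]addr0 -{1}ez -ez'.
  by rewrite addrACA [in LHS]addrACA [in RHS]addrACA [X in _ = X + _]addrACA.
- by rewrite !(affine_lie_centralZl, affine_lie_centralZr, z0) !addr0.
rewrite !affine_lie_loop !affine_lie_loop_lie /loop_lie.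
have -> : n + (k + m) = m + (n + k) by rewrite addrA addrC.
have -> : k + (m + n) = m + (n + k) by rewrite addrCA [k + n]addrC.
congr pair => /=.
  apply: fsupp_eq => i; rewrite !fsuppD !monoE; case: ifP => _; last by rewrite !addr0.
  exact: lie_jacobi.
case: eqP => [mnk|_]; last by rewrite !addr0.
have F1 : F b (lie c a) = F a (lie b c).
  by rewrite -form_inv form_sym.
have F2 : F c (lie a b) = F a (lie b c).
  by rewrite form_sym form_inv.
rewrite F1 F2; rewrite -[RHS](mul0r (F a (lie b c))) -!mulrDl; congr (_ * _).
by rewrite -!intrD -addrA mnk.
Qed.

HB.instance Definition _ := isLieAlgebra.Build K hatL
  affine_lie_linearl affine_lie_linearr affine_liexx affine_lie_jacobi.

(** [L (x) C[t] + C c].  *)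
Definition affine_nonneg : set hatL :=
  fun x => forall m : int, m < 0 -> x.1 m = 0.

Variable ell : K.

Definition level_act (x : hatL) (z : K^o) : K^o := ell * x.2 * z.

Definition vacuum_module := induced affine_nonneg level_act.
HB.instance Definition _ := GRing.Lmodule.on vacuum_module.

Definition vacuum : vacuum_module := tensor _ _ 1 1.

Definition vacuum_act (x : hatL) (v : vacuum_module) : vacuum_module :=
  ind_act x v.

Definition vacuum_inj (a : L) : vacuum_module :=
  vacuum_act (loop a (- 1)) vacuum.

End Affine.

Lemma fsuppN (K : fieldType) (X : choiceType) (M : lmodType K)
  (f : fsupp X M) x : (- f) x = - f x.
Proof. by []. Qed.

Section FrakD.
Variable K : numFieldType.
Notation term := (term K unit (int * int)).
Implicit Types a b r s : int.
Local Notation d a r := (Gen (a, r) : term).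
Local Notation delta i j t := (Scale ((i == j)%:R) t).

Inductive frakD_rel : term -> term -> Prop :=
| frakD_opp a r : frakD_rel (d (- a) r) (Opp (d a r))
| frakD_lie a r b s : frakD_rel (Lie (d a r) (d b s))
    (Add (Sub (Sub (delta (a + b) (s - r) (d (a + b) (- a + s)))
                   (delta (a + b) (r - s) (d (a + b) (a + s))))
              (delta (a - b) (s - r) (d (a - b) (- a + s))))
         (delta (a - b) (r - s) (d (a - b) (a + s)))).

Definition frakD := lie_pres frakD_rel.
HB.instance Definition _ := LieAlgebra.on frakD.

Definition dgen (a r : int) : frakD := gen (a, r).

(** Construction of the form: [d^{a,r} |-> E_{r-a,r+a} - E_{r+a,r-a}] embeds
    [frakD] in finitely supported [Z x Z] matrices, on which the form is
    [- tr(xy) / 2].  It is characterized by [frakD_formE] below.  *)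

Let mat := fsupp (int * int)%type K^o.

Let mulphi (i j : int * int) (x y : K^o) : mat :=
  if i.2 == j.1 then mono (i.1, j.2) (x * y : K^o) else 0.

Let trphi (i j : int * int) (x y : K^o) : K^o :=
  if (i.2 == j.1) && (i.1 == j.2) then x * y else 0.

Let mmul (x y : mat) : mat := ext2 mulphi x y.
Let mtr2 (x y : mat) : K^o := ext2 trphi x y.
Let mlie (x y : mat) : mat := mmul x y - mmul y x.

Let mulphil i j y : linear ((mulphi i j)^~ y).
Proof.
move=> c x x'; rewrite /mulphi; case: ifP => _; last by rewrite scaler0 addr0.
by rewrite mulrDl -scalerAl mono_linear.
Qed.

Let mulphir i j x : linear (mulphi i j x).
Proof.
move=> c y y'; rewrite /mulphi; case: ifP => _; last by rewrite scaler0 addr0.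
by rewrite mulrDr -scalerAr mono_linear.
Qed.

Let trphil i j y : linear ((trphi i j)^~ y).
Proof.
move=> c x x'; rewrite /trphi; case: ifP => _; last by rewrite scaler0 addr0.
by rewrite mulrDl -scalerAl.
Qed.

Let trphir i j x : linear (trphi i j x).
Proof.
move=> c y y'; rewrite /trphi; case: ifP => _; last by rewrite scaler0 addr0.
by rewrite mulrDr -scalerAr.
Qed.

Let mmulDl x y z : mmul (x + y) z = mmul x z + mmul y z.
Proof. exact: ext2Dl mulphil mulphir _ _ _. Qed.
Let mmulDr x y z : mmul x (y + z) = mmul x y + mmul x z.
Proof. exact: ext2Dr mulphil mulphir _ _ _. Qed.
Let mmul0l y : mmul 0 y = 0.
Proof. exact: ext20l mulphil mulphir _. Qed.
Let mmul0r y : mmul y 0 = 0.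
Proof. exact: ext20r mulphil mulphir _. Qed.
Let mmulm i j x y : mmul (mono i x) (mono j y) = mulphi i j x y.
Proof. exact: ext2_mono mulphil mulphir _ _ _ _. Qed.

Let mtrDl x y z : mtr2 (x + y) z = mtr2 x z + mtr2 y z.
Proof. exact: ext2Dl trphil trphir _ _ _. Qed.
Let mtrDr x y z : mtr2 x (y + z) = mtr2 x y + mtr2 x z.
Proof. exact: ext2Dr trphil trphir _ _ _. Qed.
Let mtr0l y : mtr2 0 y = 0.
Proof. exact: ext20l trphil trphir _. Qed.
Let mtr0r y : mtr2 y 0 = 0.
Proof. exact: ext20r trphil trphir _. Qed.
Let mtrm i j x y : mtr2 (mono i x) (mono j y) = trphi i j x y.
Proof. exact: ext2_mono trphil trphir _ _ _ _. Qed.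

Let mmulNl x y : mmul (- x) y = - mmul x y.
Proof. by apply/eqP; rewrite -addr_eq0 -mmulDl addNr mmul0l. Qed.
Let mmulNr x y : mmul x (- y) = - mmul x y.
Proof. by apply/eqP; rewrite -addr_eq0 -mmulDr addNr mmul0r. Qed.
Let mtrNl x y : mtr2 (- x) y = - mtr2 x y.
Proof. by apply/eqP; rewrite -addr_eq0 -mtrDl addNr mtr0l. Qed.
Let mtrNr x y : mtr2 x (- y) = - mtr2 x y.
Proof. by apply/eqP; rewrite -addr_eq0 -mtrDr addNr mtr0r. Qed.

Let mmulA x y z : mmul x (mmul y z) = mmul (mmul x y) z.
Proof.
elim/fsupp_ind: x => [i a|x x' ex ex'|]; last by rewrite !mmul0l.
2: by rewrite !mmulDl ex ex'.
elim/fsupp_ind: y => [j b|y y' ey ey'|]; last by rewrite !(mmul0l, mmul0r).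
2: by rewrite !(mmulDr, mmulDl) ey ey'.
elim/fsupp_ind: z => [k c|z z' ez ez'|]; last by rewrite !mmul0r.
2: by rewrite !mmulDr ez ez'.
rewrite !mmulm /mulphi; have [jk|jk] := eqVneq j.2 k.1; last first.
  rewrite mmul0r; case: ifP => _; last by rewrite mmul0l.
  by rewrite mmulm /mulphi /= (negPf jk).
rewrite mmulm /mulphi /=; case: ifP => _; last by rewrite mmul0l.
by rewrite mmulm /mulphi /= jk eqxx mulrA.
Qed.

Let mtrC x y : mtr2 x y = mtr2 y x.
Proof.
elim/fsupp_ind: x => [i a|x x' ex ex'|]; last by rewrite mtr0l mtr0r.
2: by rewrite mtrDl mtrDr ex ex'.
elim/fsupp_ind: y => [j b|y y' ey ey'|]; last by rewrite mtr0l mtr0r.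
2: by rewrite mtrDl mtrDr ey ey'.
rewrite !mtrm /trphi andbC eq_sym [i.2 == _]eq_sym.
by case: ifP => // _; exact: mulrC.
Qed.

Let mtrA x y z : mtr2 (mmul x y) z = mtr2 x (mmul y z).
Proof.
elim/fsupp_ind: x => [i a|x x' ex ex'|]; last by rewrite !(mmul0l, mtr0l).
2: by rewrite !(mmulDl, mtrDl) ex ex'.
elim/fsupp_ind: y => [j b|y y' ey ey'|]; last first.
- by rewrite !(mmul0l, mmul0r, mtr0l, mtr0r).
- by rewrite !(mmulDr, mmulDl, mtrDl, mtrDr) ey ey'.
elim/fsupp_ind: z => [k c|z z' ez ez'|]; last by rewrite !(mmul0r, mtr0r).
2: by rewrite !(mmulDr, mtrDr) ez ez'.
rewrite !mmulm /mulphi; have [ij|ij] := eqVneq i.2 j.1; last first.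
  rewrite mtr0l; case: ifP => _; last by rewrite mtr0r.
  by rewrite mtrm /trphi /= (negPf ij).
rewrite mtrm /trphi /=; case: ifP => [/andP[/eqP jk /eqP ik]|jk].
  by rewrite jk eqxx mtrm /trphi /= ij ik !eqxx mulrA.
case: ifP => [jk'|_]; last by rewrite mtr0r.
by rewrite jk' /= in jk; rewrite mtrm /trphi /= ij eqxx jk.
Qed.

Let mtr_inv x y z : mtr2 (mlie x y) z = mtr2 x (mlie y z).
Proof.
rewrite /mlie mtrDl mtrDr mtrNl mtrNr mtrA; congr (_ - _).
by rewrite mtrC -mtrA mtrC.
Qed.

Let mmulZl c x y : mmul (c *: x) y = c *: mmul x y.
Proof.
have := ext2_linearl mulphil mulphir y c x 0.
by rewrite /= -/(mmul 0 y) mmul0l !addr0.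
Qed.

Let mmulZr c x y : mmul x (c *: y) = c *: mmul x y.
Proof.
have := ext2_linearr mulphil mulphir x c y 0.
by rewrite /= -/(mmul x 0) mmul0r !addr0.
Qed.

Let mtrZl c x y : mtr2 (c *: x) y = c * mtr2 x y.
Proof.
have := ext2_linearl trphil trphir y c x 0.
by rewrite /= -/(mtr2 0 y) mtr0l !addr0.
Qed.

Let mliel (b : unit) y : linear (fun x => mlie x y).
Proof.
move=> c x x'; rewrite /mlie mmulDl mmulDr mmulZl mmulZr scalerBr opprD.
by rewrite addrACA.
Qed.

Let mlier (b : unit) x : linear (mlie x).
Proof.
move=> c y y'; rewrite /mlie mmulDl mmulDr mmulZl mmulZr scalerBr opprD.
by rewrite addrACA.
Qed.

Let E (i j : int) : mat := mono (i, j) (1 : K^o).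
Let dmat (x : int * int) : mat :=
  E (x.2 - x.1) (x.2 + x.1) - E (x.2 + x.1) (x.2 - x.1).

Let EE i j k l : mmul (E i j) (E k l) = if j == k then E i l else 0.
Proof. by rewrite /E mmulm /mulphi /= mulr1. Qed.

Let EEtr i j k l : mtr2 (E i j) (E k l) = ((j == k) && (i == l))%:R.
Proof. by rewrite /E mtrm /trphi /= mulr1; case: ifP. Qed.

Let dmat_lie a r b s :
  mlie (dmat (a, r)) (dmat (b, s)) =
    (a + b == s - r)%:R *: dmat (a + b, - a + s)
    - (a + b == r - s)%:R *: dmat (a + b, a + s)
    - (a - b == s - r)%:R *: dmat (a - b, - a + s)
    + (a - b == r - s)%:R *: dmat (a - b, a + s).
Proof.
rewrite /mlie /dmat /= !(mmulDl, mmulDr, mmulNl, mmulNr) !EE !opprK.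
have -> : (r + a == s - b) = (a + b == s - r) by lia.
have -> : (r + a == s + b) = (a - b == s - r) by lia.
have -> : (r - a == s - b) = (a - b == r - s) by lia.
have -> : (r - a == s + b) = (a + b == r - s) by lia.
have -> : (s + b == r - a) = (a + b == r - s) by lia.
have -> : (s + b == r + a) = (a - b == s - r) by lia.
have -> : (s - b == r - a) = (a - b == r - s) by lia.
have -> : (s - b == r + a) = (a + b == s - r) by lia.
have D (c : bool) g k i j : (c -> k - g = i /\ k + g = j) ->
    c%:R *: dmat (g, k) = (if c then E i j else 0) - (if c then E j i else 0).
  case: c => [/(_ isT) [<- <-]|_]; first by rewrite scale1r.
  by rewrite scale0r subr0.
rewrite (D _ _ _ (r - a) (s + b)); last by move/eqP; lia.
rewrite (D _ _ _ (s - b) (r + a)); last by move/eqP; lia.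
rewrite (D _ _ _ (r - a) (s - b)); last by move/eqP; lia.
rewrite (D _ _ _ (s + b) (r + a)); last by move/eqP; lia.
apply: fsupp_eq => x; rewrite !(fsuppD, fsuppN).
have abel (p1 p2 p3 p4 p5 p6 p7 p8 : K) :
    (p1 - p2 + (- p3 + p4)) - (p5 - p6 + (- p7 + p8)) =
    p1 - p8 - (p5 - p4) - (p2 - p6) + (p7 - p3) by ring.
exact: abel.
Qed.

Let mop (u : unit) := mlie.

Let mop_rel (s t : term) : lie_rel frakD_rel s t -> eval mop dmat s = eval mop dmat t.
Proof.
have mliexx x : mlie x x = 0 by rewrite /mlie subrr.
case=> {s t} /=.
- move=> s t; case=> {s t} [a r|a r b s] /=.
    by rewrite /dmat /= opprK scaleN1r opprB.
  by rewrite /mop dmat_lie !scaleN1r.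
- by move=> t; exact: mliexx.
- move=> s t u; rewrite /mop.
  move: (eval _ _ s) (eval _ _ t) (eval _ _ u) => x y z.
  rewrite /mlie !(mmulDl, mmulDr, mmulNl, mmulNr) !mmulA !opprD !opprK.
  apply: fsupp_eq => i; rewrite !(fsuppD, fsuppN) fsupp0.
  have abel (xyz xzy yzx zyx yxz zxy : K) :
    xyz - xzy + (- yzx + zyx) + (yzx - yxz + (- zxy + xzy)) +
    (zxy - zyx + (- xyz + yxz)) = 0 by ring.
  exact: abel.
Qed.

Let toM : frakD -> mat := lift mop dmat.

Let toM_linear : linear toM.
Proof. exact: lift_linear mliel mlier mop_rel. Qed.

Let toM_lie x y : toM (lie x y) = mlie (toM x) (toM y).
Proof. exact: (lift_op mliel mlier mop_rel tt). Qed.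

Let toM_gen a r : toM (dgen a r) = dmat (a, r).
Proof. exact: (lift_gen mliel mlier mop_rel). Qed.

Definition frakD_form_fun (x y : frakD) : K := - 2^-1 * mtr2 (toM x) (toM y).

Fact frakD_form_linear y : scalar (frakD_form_fun^~ y).
Proof.
move=> c x x'; rewrite /frakD_form_fun toM_linear mtrDl mtrZl mulrDr.
by rewrite mulrCA.
Qed.

Fact frakD_form_sym x y : frakD_form_fun x y = frakD_form_fun y x.
Proof. by rewrite /frakD_form_fun mtrC. Qed.

Fact frakD_form_inv x y z :
  frakD_form_fun (lie x y) z = frakD_form_fun x (lie y z).
Proof. by rewrite /frakD_form_fun !toM_lie mtr_inv. Qed.

Definition frakD_form : inv_form frakD :=
  InvForm frakD_form_linear frakD_form_sym frakD_form_inv.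

Lemma frakD_formE a r b s :
  frakD_form (dgen a r) (dgen b s) =
    (r == s)%:R * ((a - b == 0)%:R - (a + b == 0)%:R).
Proof.
rewrite /= /frakD_form_fun !toM_gen /dmat /=.
rewrite !(mtrDl, mtrDr, mtrNl, mtrNr) !EEtr !opprK.
have -> : (r + a == s - b) && (r - a == s + b) = (r == s) && (a + b == 0) by lia.
have -> : (r + a == s + b) && (r - a == s - b) = (r == s) && (a - b == 0) by lia.
have -> : (r - a == s - b) && (r + a == s + b) = (r == s) && (a - b == 0) by lia.
have -> : (r - a == s + b) && (r + a == s - b) = (r == s) && (a + b == 0) by lia.
have two : 2 != 0 :> K by rewrite pnatr_eq0.
case: (r == s); case: (a - b == 0); case: (a + b == 0) => /=; by field.
Qed.

End FrakD.

Section QVirasoro.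
Variables (K : fieldType) (q : K).
Implicit Types (a b m n : int).

Definition qint (p : K) (n : int) : K :=
  if p == 1 then n%:~R else (p ^ (- n) - p ^ n) / (p^-1 - p).

Inductive qvir_gen := QVc | QVD of int & int.

Local Notation D a n := (Gen (QVD a n)).
Local Notation c := (Gen QVc).

Inductive qvir_rel : term K unit qvir_gen -> term K unit qvir_gen -> Prop :=
| qvir_central t : qvir_rel (Lie c t) Zero
| qvir_opp a n : qvir_rel (D (- a) n) (Opp (D a n))
| qvir_lie a n b m : qvir_rel (Lie (D a n) (D b m))
    (Add (Sub (Scale ((q - q^-1) * qint q (a * m - b * n)) (D (a + b) (m + n)))
              (Scale ((q - q^-1) * qint q (a * m + b * n)) (D (a - b) (m + n))))
         (Scale ((qint (q ^ (a + b)) m - qint (q ^ (a - b)) m)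
                   * (m + n == 0)%:R) c)).

Definition qvir := lie_pres qvir_rel.
HB.instance Definition _ := LieAlgebra.on qvir.

Definition qvirD (a n : int) : qvir := gen (QVD a n).
Definition qvirc : qvir := gen QVc.

Variables (W : lmodType K) (rho : lie_module qvir W).

Definition restricted : Prop :=
  forall a w, exists N : int, forall n, N <= n -> rho (qvirD a n) w = 0.

Definition of_level (ell : K) : Prop := forall w, rho qvirc w = ell *: w.

(** Coefficient of [x^n] in [\hat D^a(x) w]; as
    [x D^a(x) = sum_n D^a(n) x^(-n)], the index is [- n].  *)
Definition hatD (a n : int) (w : W) : W :=
  rho (qvirD a (- n)) w
  - (if (a != 0) && (n == 0) then (q ^ (- a) - q ^ a)^-1 *: rho qvirc w else 0).

(** Coefficient of [x^n] in [\hat D^{a,r}(x) w = \hat D^a(q^r x) w].  *)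
Definition hatDr (a r n : int) (w : W) : W := (q ^ r) ^ n *: hatD a n w.

End QVirasoro.

Section VertexAlgebra.
Variables (K : numFieldType) (V : lmodType K).

Definition binomz (m : int) (i : nat) : K :=
  (\prod_(j < i) (m - j%:Z)%:~R) / i`!%:R.

(** [Y u n v] is [u_n v], that is [Y(u, x) v = sum_n (u_n v) x^(-n-1)]; the
    Jacobi identity is stated in components (Borcherds identity), all sums
    being finite by truncation.  *)
Record vertex_algebra := VertexAlgebra {
  vmode :> V -> int -> V -> V;
  vac : V;
  vmode_linearl : forall n v, linear (fun u => vmode u n v);
  vmode_linearr : forall u n, linear (vmode u n);
  vmode_trunc : forall u v, exists N : int, forall n, N <= n -> vmode u n v = 0;
  vmode_vac : forall n v, vmode vac n v = if n == - 1 then v else 0;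
  vmode_creation : forall u, vmode u (- 1) vac = u;
  vmode_creation0 : forall u n, 0 <= n -> vmode u n vac = 0;
  vmode_jacobi : forall (u v w : V) (l m n : int),
    \sum_(i \in [set: nat])
      binomz m i *: vmode (vmode u (l + i%:Z) v) (m + n - i%:Z) w =
    \sum_(i \in [set: nat]) ((- 1) ^+ i * binomz l i) *:
      (vmode u (l + m - i%:Z) (vmode v (n + i%:Z) w)
       - (- 1) ^ l *: vmode v (l + n - i%:Z) (vmode u (m + i%:Z) w))
}.

Definition va_automorphism (Y : vertex_algebra) (g : V -> V) : Prop :=
  [/\ linear g, bijective g, g (vac Y) = vac Y &
      forall u n v, g (Y u n v) = Y (g u) n (g v)].

End VertexAlgebra.

Arguments loop {K L F}.
Arguments vacuum_inj {K L F ell}.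
Arguments vacuum_act {K L F ell}.
Arguments dgen {K}.

(** The structure of [V_{\hat L}(ell, 0)]: [Y(a, x) = sum_n (a (x) t^n) x^(-n-1)]
    for [a] in [L]; it is unique with this property.  *)
Definition affine_va_structure (K : numFieldType) (L : lieAlgType K)
    (F : inv_form L) (ell : K) (Y : vertex_algebra (vacuum_module F ell)) : Prop :=
  vac Y = vacuum F ell /\
  forall a n v, Y (vacuum_inj a) n v = vacuum_act (loop a n) v.

Notation VfrakD ell := (vacuum_module (frakD_form _) ell).

(** Here [phi(x, z) = x e^z].  A series in [W[[x, x^-1]]] is given by its coefficients [int -> W], a
    series in [W[[x1, x1^-1, x2, x2^-1]]] by [int -> int -> W]; [YW v w n] is
    the coefficient of [x^n] in [Y_W(v, x) w].  *)

Section PhiModule.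
Variables (K : numFieldType) (V : lmodType K) (Y : vertex_algebra V).
Variables (W : lmodType K) (YW : V -> W -> int -> W).
Implicit Types (p : {poly K}) (A : int -> int -> W).

(** [W((x))] and [W((x1, x2))].  *)
Definition laurent (f : int -> W) : Prop :=
  exists N : int, forall n, n < N -> f n = 0.

Definition laurent2 A : Prop :=
  exists N : int, forall m n, (m < N) || (n < N) -> A m n = 0.

(** [Y_W(u, x1) Y_W(v, x2) w].  *)
Definition YW2 (u v : V) (w : W) : int -> int -> W :=
  fun m n => YW u (YW v w n) m.

(** [p(x1 / x2) A(x1, x2)].  *)
Definition ratio_mul p A : int -> int -> W :=
  fun m n => \sum_(i < size p) p`_i *: A (m - i%:Z) (n + i%:Z).

(** Coefficient of [z^k] in [p(e^z)].  *)
Definition expcoef p (k : nat) : K :=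
  \sum_(i < size p) p`_i * (i%:R ^+ k / k`!%:R).

(** Coefficient of [z^k x2^j] in [A(x2 e^z, x2)], for [A] in [W((x1, x2))].  *)
Definition subst_exp A (k : int) (j : int) : W :=
  if k is Posz k then
    \sum_(m \in [set: int]) (m%:~R ^+ k / k`!%:R) *: A m (j - m)
  else 0.

(** Coefficient of [z^k x2^j] in [p(e^z) Y_W(Y(u, z) v, x2) w].  *)
Definition exp_mul_iterate p (u v : V) (w : W) (k j : int) : W :=
  \sum_(a \in [set: nat]) expcoef p a *: YW (Y u (a%:Z - k - 1) v) w j.

Definition quasi_compatible p (u v : V) : Prop :=
  forall w, laurent2 (ratio_mul p (YW2 u v w)).

Definition phi_quasi_module : Prop :=
  [/\ forall w n, linear (fun v => YW v w n),
      forall v n, linear (fun w => YW v w n),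
      forall v w, laurent (YW v w),
      forall w n, YW (vac Y) w n = (if n == 0 then w else 0) &
      forall u v, exists p, [/\ p != 0, quasi_compatible p u v &
        forall w k j, exp_mul_iterate p u v w k j =
                      subst_exp (ratio_mul p (YW2 u v w)) k j]].

Definition equivariant_phi_quasi_module (G : Type) (act : G -> V -> V)
    (chi : G -> K) : Prop :=
  [/\ phi_quasi_module,
      forall g v w n, YW (act g v) w n = chi g ^ n *: YW v w n &
      forall u v, exists p, [/\ p != 0,
        forall x, root p x -> exists g, x = chi g & quasi_compatible p u v]].

End PhiModule.

(* Main.v *)
Require Import Defs.
From HB Require Import structures.
From mathcomp Require Import all_boot all_order all_algebra.
From mathcomp Require Import complex reals.
From mathcomp Require Import finmap boolp classical_sets functions cardinality.
From mathcomp Require Import fsbigop zify ring.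
Set Implicit Arguments.
Unset Strict Implicit.
Unset Printing Implicit Defensive.
Import Order.TTheory GRing.Theory Num.Theory.
Local Open Scope ring_scope.
Local Open Scope complex_scope.

(** Fix [w] and a total degree [N]. The coefficients [a m] and [b m] of
    [x1^m x2^(N - m)] in [Y_W(u, x1) Y_W(v, x2) w] and in [Y_W(v, x2) Y_W(u, x1) w]
    vanish for large, resp. very negative [m].  A polynomial [P(x1 / x2)] turns
    both into the same Laurent polynomial [f] (weak associativity and skew symmetry of
    the vertex algebra), so they are the expansions at infinity and at 0 of one rational
    function [f / P].  Equivariance puts all its poles in the powers of [q];
    weak associativity for [sigma k u] and [v] says that its expansion at
    [q^k e^z] is the coefficient of [x2^N] in [Y_W(Y(sigma k u, z) v, x2) w].  For [u], [v]
    in the Lie algebra, [Y(u, z) v] has a pole of order at most 2, hence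
    [a m - b m] is the sum over [k] of [q^(-k m)] times
    [Y_W([sigma k u, v], x2)] minus [m ell <sigma k u, v>], in degree [N].
    For the generators these are the relations of the q-Virasoro algebra. *)

(** * Doubly infinite sequences and Laurent polynomials *)

Lemma linear_map0 (K : pzRingType) (U V : lmodType K) (f : U -> V) :
  linear f -> f 0 = 0.
Proof. by move=> lf; have := lf (-1) 0 0; rewrite scaler0 addr0 scaleN1r addNr. Qed.

Lemma linear_mapZ (K : pzRingType) (U V : lmodType K) (f : U -> V) c x :
  linear f -> f (c *: x) = c *: f x.
Proof. by move=> lf; have := lf c x 0; rewrite (linear_map0 lf) !addr0. Qed.

Lemma linear_mapD (K : pzRingType) (U V : lmodType K) (f : U -> V) x y :
  linear f -> f (x + y) = f x + f y.
Proof. by move=> lf; have := lf 1 x y; rewrite !scale1r. Qed.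

Lemma linear_mapN (K : pzRingType) (U V : lmodType K) (f : U -> V) x :
  linear f -> f (- x) = - f x.
Proof. by move=> lf; rewrite -scaleN1r linear_mapZ // scaleN1r. Qed.

Section FiniteSums.
Variables (K : pzRingType) (W : lmodType K).
Implicit Types (F G : int -> W).

(** Coefficients of a Laurent polynomial; the symmetric bound gives two sequences a common summation
    window. *)
Definition fin_seq F := exists n : nat, forall m : int, (n < `|m|)%N -> F m = 0.

(** The value at [x = 1] of a Laurent polynomial. An infinitely supported sum is 0 by convention,
    hence the [fin_seq] hypotheses of the additivity lemmas. *)
Definition isum F : W := \sum_(m \in [set: int]) F m.

Lemma isumE (n : nat) F : (forall m : int, (n < `|m|)%N -> F m = 0) ->
  isum F = \sum_(0 <= i < n.*2.+1) F (i%:Z - n%:Z).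
Proof.
move=> F0; rewrite /isum (@fsbigE _ _ _ _ _ [seq i%:Z - n%:Z | i <- index_iota 0 n.*2.+1]).
- rewrite big_map; apply: eq_bigl => i.
  by apply/mem_set.
- by rewrite map_inj_uniq ?iota_uniq // => i j; lia.
- by [].
- move=> m _ mr; apply: F0; apply: contraNT mr => mn.
  apply/mapP; exists (absz (m + n%:Z)%R); last by lia.
  by rewrite mem_index_iota; lia.
Qed.

Lemma fin_seq_common F G : fin_seq F -> fin_seq G ->
  exists n : nat, (forall m : int, (n < `|m|)%N -> F m = 0) /\
                  (forall m : int, (n < `|m|)%N -> G m = 0).
Proof.
move=> [n Fn] [p Gp]; exists (maxn n p).
by split=> m mn; [apply: Fn | apply: Gp]; lia.
Qed.

Lemma fin_seqD F G : fin_seq F -> fin_seq G -> fin_seq (F + G).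
Proof.
move=> fF fG; have [n [Fn Gn]] := fin_seq_common fF fG.
by exists n => m mn; rewrite fctE Fn ?Gn // addr0.
Qed.

Lemma fin_seqB F G : fin_seq F -> fin_seq G -> fin_seq (F - G).
Proof.
move=> fF fG; have [n [Fn Gn]] := fin_seq_common fF fG.
by exists n => m mn; rewrite -[LHS]/(F m - G m) Fn ?Gn // subr0.
Qed.

Lemma fin_seq0 : fin_seq 0. Proof. by exists 0%N. Qed.

Lemma fin_seq_sum I (r : seq I) (P : pred I) (F : I -> int -> W) :
  (forall i, P i -> fin_seq (F i)) -> fin_seq (\sum_(i <- r | P i) F i).
Proof.
by move=> fF; elim/big_ind: _ => //; [exact: fin_seq0 | exact: fin_seqD].
Qed.

Lemma fin_seq_weight (c : int -> K) F : fin_seq F -> fin_seq (fun m => c m *: F m).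
Proof. by case=> n Fn; exists n => m /Fn ->; rewrite scaler0. Qed.

Lemma fin_seq_shift (c : int) F : fin_seq F -> fin_seq (fun m => F (m + c)).
Proof. by case=> n Fn; exists (n + `|c|)%N => m mn; apply: Fn; lia. Qed.

Lemma fin_seq_refl (c : int) F : fin_seq F -> fin_seq (fun m => F (c - m)).
Proof. by case=> n Fn; exists (n + `|c|)%N => m mn; apply: Fn; lia. Qed.

Lemma isumD F G : fin_seq F -> fin_seq G -> isum (F + G) = isum F + isum G.
Proof.
move=> fF fG; have [n [Fn Gn]] := fin_seq_common fF fG.
have FGn m : (n < `|m|)%N -> (F + G) m = 0 by move=> mn; rewrite fctE Fn ?Gn // addr0.
by rewrite (isumE FGn) (isumE Fn) (isumE Gn) -big_split.
Qed.

Lemma isum0 : isum 0 = 0.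
Proof. exact: fsbig1. Qed.

Lemma isumZ c F : fin_seq F -> isum (fun m => c *: F m) = c *: isum F.
Proof.
case=> n Fn; have cFn m : (n < `|m|)%N -> c *: F m = 0 by move/Fn->; rewrite scaler0.
by rewrite (isumE cFn) (isumE Fn) scaler_sumr.
Qed.

Lemma isum_sum I (r : seq I) (P : pred I) (F : I -> int -> W) :
    (forall i, P i -> fin_seq (F i)) ->
  isum (fun m => \sum_(i <- r | P i) F i m) = \sum_(i <- r | P i) isum (F i).
Proof.
move=> fF; have -> : (fun m => \sum_(i <- r | P i) F i m) = \sum_(i <- r | P i) F i.
  by apply/funext => m; rewrite fct_sumE.
suff [] : fin_seq (\sum_(i <- r | P i) F i) /\
          isum (\sum_(i <- r | P i) F i) = \sum_(i <- r | P i) isum (F i) by [].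
elim/big_rec2: _ => [|i x y Pi [fy <-]]; first by rewrite isum0; split=> //; exact: fin_seq0.
by split; [apply: fin_seqD => //; exact: fF | rewrite isumD //; exact: fF].
Qed.

Lemma isum_shift (c : int) F : isum (fun m => F (m + c)) = isum F.
Proof.
rewrite /isum [RHS](@reindex_fsbigT _ _ _ _ _ (fun m => m + c)) //.
by exists (fun m => m - c) => m; rewrite ?addrK ?subrK.
Qed.

Lemma isum_refl (c : int) F : isum (fun m => F (c - m)) = isum F.
Proof.
rewrite /isum [RHS](@reindex_fsbigT _ _ _ _ _ (fun m => c - m)) //.
by exists (fun m => c - m) => m; rewrite subKr.
Qed.

End FiniteSums.

Section PolyAction.
Variables (K : comNzRingType) (W : lmodType K).
Implicit Types (a b : int -> W) (p q : {poly K}).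

(** [x] acts on [sum_m a m x^m] by multiplication. *)
Definition pact p a : int -> W :=
  fun m => \sum_(i < size p) p`_i *: a (m - i%:Z).

Lemma pactE n p a m : (size p <= n)%N ->
  pact p a m = \sum_(i < n) p`_i *: a (m - i%:Z).
Proof.
move=> pn; rewrite /pact (big_ord_widen n (fun i => p`_i *: a (m - i%:Z))) //.
rewrite big_mkcond; apply: eq_bigr => i _; case: ltnP => // pi.
by rewrite nth_default // scale0r.
Qed.

Lemma pactDl p q a : pact (p + q) a = pact p a + pact q a.
Proof.
apply/funext => m; rewrite fctE.
rewrite (@pactE (maxn (size p) (size q)) (p + q)) ?size_polyD //.
rewrite (@pactE (maxn (size p) (size q)) p) ?leq_maxl //.
rewrite (@pactE (maxn (size p) (size q)) q) ?leq_maxr // -big_split /=.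
by apply: eq_bigr => i _; rewrite coefD scalerDl.
Qed.

Lemma pactDr p a b : pact p (a + b) = pact p a + pact p b.
Proof.
apply/funext => m; rewrite -[RHS]/(pact p a m + pact p b m) /pact -big_split /=.
by apply: eq_bigr => i _; rewrite scalerDr.
Qed.

Lemma pactZr p c a : pact p (c *: a) = c *: pact p a.
Proof.
apply/funext => m; rewrite -[RHS]/(c *: pact p a m) /pact scaler_sumr.
by apply: eq_bigr => i _; rewrite -[(c *: a) _]/(c *: a _) !scalerA mulrC.
Qed.

Lemma pactNr p a : pact p (- a) = - pact p a.
Proof. by rewrite -scaleN1r pactZr scaleN1r. Qed.

Lemma pactBr p a b : pact p (a - b) = pact p a - pact p b.
Proof. by rewrite pactDr pactNr. Qed.

Lemma pact0r p : pact p 0 = 0.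
Proof. by have := pactZr p 0 0; rewrite !scale0r. Qed.

Lemma pactC c a : pact c%:P a = c *: a.
Proof.
apply/funext => m; rewrite (@pactE 1) ?size_polyC_leq1 // big_ord1.
by rewrite coefC eqxx subr0.
Qed.

Lemma pactMX p a m : pact (p * 'X) a m = pact p a (m - 1).
Proof.
have sz : (size (p * 'X)%R <= (size p).+1)%N.
  by rewrite (leq_trans (size_polyMleq _ _)) // size_polyX addn2.
rewrite (pactE _ _ sz) big_ord_recl coefMX eqxx scale0r add0r.
apply: eq_bigr => i _; rewrite coefMX /=; congr (_ *: a _).
by rewrite /bump; lia.
Qed.

(** Two-sided series form a module over [K[x]]: Horner induction on [p] reduces to constants and to
    [x], which acts by a shift. *)
Lemma pactM p q a : pact (p * q) a = pact p (pact q a).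
Proof.
elim/poly_ind: p => [|p c IHp]; first by rewrite mul0r -polyC0 !pactC !scale0r.
have pactZl : pact (c%:P * q) a = c *: pact q a.
  apply/funext => m; rewrite -[RHS]/(c *: pact q a m) (@pactE (size q)); last first.
    by rewrite mul_polyC size_scale_leq.
  rewrite /pact scaler_sumr; apply: eq_bigr => i _.
  by rewrite coefCM scalerA.
rewrite mulrDl !pactDl pactC pactZl; congr (_ + _).
by apply/funext => m; rewrite mulrAC !pactMX IHp.
Qed.

Lemma pactCA p q a : pact p (pact q a) = pact q (pact p a).
Proof. by rewrite -!pactM mulrC. Qed.

Lemma pact_XsubC c a m : pact ('X - c%:P) a m = a (m - 1) - c *: a m.
Proof.
rewrite pactDl -polyCN pactC scaleNr fctE -['X]mul1r pactMX -polyC1 pactC.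
by rewrite scale1r.
Qed.

Lemma fin_pact p a : fin_seq a -> fin_seq (pact p a).
Proof.
move=> fa.
have -> : pact p a = \sum_(i < size p) (fun m => p`_i *: a (m - i%:Z)).
  by apply/funext => m; rewrite fct_sumE.
apply: fin_seq_sum => i _; apply: fin_seq_weight.
exact: (fin_seq_shift (- i%:Z)).
Qed.

End PolyAction.

(** * Laurent series in z and the substitution x = e^z *)

Section ExponentialSeries.
Variable K : numFieldType.

(** The coefficients of [e^(c z)]. *)
Definition expser (c : K) (k : nat) : K := c ^+ k / k`!%:R.

Lemma expserD x y k :
  expser (x + y) k = \sum_(i < k.+1) expser y i * expser x (k - i).
Proof.
rewrite /expser exprDn mulr_suml; apply: eq_bigr => i _.
have ik : (i <= k)%N by rewrite -ltnS.
have nz n : n`!%:R != 0 :> K by rewrite pnatr_eq0 -lt0n fact_gt0.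
rewrite -mulr_natr -(bin_fact ik) !natrM.
have : 'C(k, i)%:R != 0 :> K by rewrite pnatr_eq0 -lt0n bin_gt0.
move: (nz i) (nz (k - i)%N) => h1 h2 h3.
by field; rewrite h1 h2 h3.
Qed.

End ExponentialSeries.

Section LaurentAction.
Variables (K : numFieldType) (W : lmodType K).
Implicit Types (s t : nat -> K) (H : int -> W).

(** [H] stands for [sum_k H k z^k] and [s] for [sum_k s k z^k]. *)
Definition lact s H : int -> W :=
  fun k => \sum_(i \in [set: nat]) s i *: H (k - i%:Z).

Definition smul s t : nat -> K := fun k => \sum_(i < k.+1) s i * t (k - i)%N.

Lemma lactE (n : nat) s H k : (forall l : int, l <= k - n%:Z -> H l = 0) ->
  lact s H k = \sum_(i < n) s i *: H (k - i%:Z).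
Proof.
move=> H0; rewrite /lact (@fsbigE _ _ _ _ _ (index_iota 0 n)).
- rewrite -(big_mkord predT (fun i => s i *: H (k - i%:Z))).
  by apply: eq_bigl => i; apply/mem_set.
- exact: iota_uniq.
- by [].
- move=> i _; rewrite mem_index_iota /= -leqNgt => ni.
  by rewrite H0 ?scaler0 //; lia.
Qed.

Lemma lact_laurent s H : laurent H -> laurent (lact s H).
Proof.
case=> N HN; exists N => k kN; rewrite (@lactE 0) ?big_ord0 // => l lk.
by apply: HN; lia.
Qed.

Lemma lactC s t H : laurent H -> lact s (lact t H) = lact t (lact s H).
Proof.
move=> lH; apply/funext => k; have [N HN] := lH.
have two s' t' : lact s' (lact t' H) k =
    \sum_(i < (absz (k - N)).+1) \sum_(j < (absz (k - N)).+1)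
      (s' i * t' j) *: H (k - i%:Z - j%:Z).
  rewrite (@lactE (absz (k - N)).+1) => [|l lk].
    apply: eq_bigr => i _; rewrite (@lactE (absz (k - N)).+1) => [|l lk].
      by rewrite scaler_sumr; apply: eq_bigr => j _; rewrite scalerA.
    by apply: HN; lia.
  rewrite (@lactE 0) ?big_ord0 // => l' lk'; apply: HN; lia.
rewrite !two exchange_big; apply: eq_bigr => i _; apply: eq_bigr => j _.
by rewrite mulrC; congr (_ *: H _); rewrite addrAC.
Qed.

Lemma lactA s t H : laurent H -> lact (smul s t) H = lact s (lact t H).
Proof.
move=> lH; apply/funext => k; have [N HN] := lH.
set n := (absz (k - N)).+1.
have H0 (l : int) : l <= k - n%:Z -> H l = 0 by move=> ?; apply: HN; lia.
rewrite (lactE _ H0) (@lactE n) => [|l lk]; last first.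
  by rewrite (@lactE 0) ?big_ord0 // => l' lk'; apply: HN; lia.
transitivity (\sum_(l < n) \sum_(i < n | (i <= l)%N) (s i * t (l - i)%N) *: H (k - l%:Z)).
  apply: eq_bigr => l _; rewrite scaler_suml.
  by rewrite (big_ord_widen n (fun i : nat => (s i * t (l - i)%N) *: H (k - l%:Z))).
rewrite (exchange_big_dep predT) //=; apply: eq_bigr => i _.
rewrite (@lactE (n - i)) => [|l lk]; last by apply: H0; have := ltn_ord i; lia.
rewrite scaler_sumr -(big_mkord predT (fun j => s i *: (t j *: H (k - i%:Z - j%:Z)))).
rewrite -(big_mkord (fun l => (i <= l)%N) (fun l => (s i * t (l - i)%N) *: H (k - l%:Z))).
rewrite (@big_cat_nat _ _ _ i) //=; last exact: ltnW.
rewrite big_nat_cond big1 ?add0r => [|j /andP[/andP[_ ji] ij]]; last by lia.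
rewrite -{1}[nat_of_ord i]add0n big_addn big_nat_cond [RHS]big_nat_cond.
apply: eq_big => j; first by rewrite leq_addl.
by rewrite addnK scalerA => _; congr (_ *: H _); lia.
Qed.

Lemma lactB s H H' : laurent H -> laurent H' -> lact s (H - H') = lact s H - lact s H'.
Proof.
move=> [N HN] [N' HN']; apply/funext => k.
set n := ((absz (k - N)) + absz (k - N')).+1.
have H0 (l : int) : l <= k - n%:Z -> H l = 0 by move=> ?; apply: HN; lia.
have H0' (l : int) : l <= k - n%:Z -> H' l = 0 by move=> ?; apply: HN'; lia.
rewrite -[RHS]/(lact s H k - lact s H' k) (lactE _ H0) (lactE _ H0').
rewrite (@lactE n) => [|l lk]; last by rewrite -[LHS]/(H l - H' l) H0 ?H0' ?subr0.
rewrite -sumrB; apply: eq_bigr => i _.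
by rewrite -[(H - H') _]/(H _ - H' _) scalerBr.
Qed.

(** The lowest nonzero coefficient of [s] meets the lowest possible coefficient of [H] with nothing
    to cancel it, so the coefficients of [H] vanish one after the other from the left. *)
Lemma lact_eq0 s H : laurent H -> (exists i, s i != 0) -> lact s H = 0 -> H = 0.
Proof.
move=> [N HN] s0 sH0; set i := ex_minn s0.
have [si0 smin] : s i != 0 /\ forall j, (j < i)%N -> s j = 0.
  rewrite /i; case: ex_minnP => j sj jmin; split=> // l lj.
  by apply/eqP; apply: contraLR lj => /jmin; rewrite -leqNgt.
suff Hn (n : nat) : forall l : int, l < N + n%:Z -> H l = 0.
  by apply/funext => l; apply: (Hn (absz (l - N)).+1); lia.
elim: n => [|n IHn] l ln; first by apply: HN; lia.
have [/IHn//|ln'] := ltrP l (N + n%:Z).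
have : lact s H (l + i%:Z) = 0 by rewrite sH0.
rewrite (@lactE i.+1) => [|l' l'l]; last by apply: IHn; lia.
rewrite big_ord_recr big1 => [/=|j _]; last by rewrite smin /= ?scale0r ?ltn_ord. 
rewrite add0r addrK => /eqP; rewrite scaler_eq0 (negPf si0) /=. by move/eqP.
Qed.

Lemma lact_inj s H H' : laurent H -> laurent H' -> (exists i, s i != 0) ->
  lact s H = lact s H' -> H = H'.
Proof.
move=> lH lH' s0 /eqP; rewrite -subr_eq0 -lactB // => /eqP e.
apply/eqP; rewrite -subr_eq0; apply/eqP/(lact_eq0 _ s0 e).
case: lH lH' => N HN [N' HN']; exists (Num.min N N') => l; rewrite lt_min => /andP[lN lN'].
by rewrite -[LHS]/(H l - H' l) HN ?HN' ?subr0.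
Qed.

Lemma smul_exp (x y : K) : smul (expser y) (expser x) = expser (x + y).
Proof. by apply/funext => k; rewrite expserD. Qed.

(** The substitution [z -> - z]. *)
Definition negz H : int -> W := fun k => (- 1) ^ k *: H k.

Definition negzs s : nat -> K := fun k => (- 1) ^+ k * s k.

Lemma negz_lact s H : laurent H -> negz (lact s H) = lact (negzs s) (negz H).
Proof.
move=> [N HN]; apply/funext => k; rewrite /negz.
set n := (absz (k - N)).+1.
rewrite !(@lactE n) => [|l lk|l lk]; last 2 first.
- by rewrite HN ?scaler0 //; lia.
- by apply: HN; lia.
rewrite scaler_sumr; apply: eq_bigr => i _; rewrite /negzs !scalerA.
congr (_ *: _).
rewrite [LHS]mulrC [RHS]mulrAC [RHS]mulrC; congr (_ * _).
rewrite exprnP -expfzDr ?oppr_eq0 ?oner_eq0 //.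
by congr (_ ^ _); lia.
Qed.

Lemma negz_laurent H : laurent H -> laurent (negz H).
Proof. by case=> N HN; exists N => k /HN; rewrite /negz => ->; rewrite scaler0. Qed.

End LaurentAction.

(* A Lagrange polynomial separates the nodes. *)
Lemma powers_indep (K : idomainType) (W : lmodType K) n (x : 'I_n -> K)
    (w : 'I_n -> W) : (forall (a : K) (v : W), a *: v = 0 -> a = 0 \/ v = 0) ->
    injective x -> (forall k, \sum_(i < n) x i ^+ k *: w i = 0) ->
  forall i, w i = 0.
Proof.
move=> tf xI wx i; pose h : {poly K} := \prod_(j < n | j != i) ('X - (x j)%:P).
have hj j : h.[x j] = if j == i then h.[x i] else 0.
  have [->//|ji] := eqVneq; rewrite /h horner_prod (bigD1 j) //=.
  by rewrite hornerXsubC subrr mul0r.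
have : \sum_(l < n) h.[x l] *: w l = 0.
  under eq_bigr => l _ do rewrite horner_coef scaler_suml.
  rewrite exchange_big big1 // => k _.
  under eq_bigr => l _ do rewrite -scalerA.
  by rewrite -scaler_sumr wx scaler0.
rewrite (bigD1 i) //= big1 ?addr0 => [/tf[/eqP|//]|l /negPf li]; last first.
  by rewrite hj li scale0r.
rewrite /h horner_prod prodf_seq_eq0 => /hasP[j _ /andP[ji]].
by rewrite hornerXsubC subr_eq0 (inj_eq xI) eq_sym (negPf ji).
Qed.

Section ExpSubst.
Variables (K : numFieldType) (W : lmodType K).
Implicit Types (f g : int -> W) (p : {poly K}).

(** The coefficients of [f(e^z)], for a Laurent polynomial [f]. *)
Definition evz f : int -> W := fun k =>
  if k is Posz n then isum (fun m : int => expser m%:~R n *: f m) else 0.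

Lemma evz_laurent f : laurent (evz f).
Proof. by exists 0; case. Qed.

Lemma lact_nonneg (s : nat -> K) (H : int -> W) (k : nat) :
  (forall l : int, l < 0 -> H l = 0) ->
  lact s H k%:Z = \sum_(i < k.+1) s i *: H (k - i)%N%:Z.
Proof.
move=> H0; rewrite (@lactE _ _ k.+1) => [|l lk]; last by apply: H0; lia.
by apply: eq_bigr => i _; rewrite -subzn // -ltnS.
Qed.

Lemma lact_neg (s : nat -> K) (H : int -> W) (k : int) :
  (forall l : int, l < 0 -> H l = 0) -> k < 0 -> lact s H k = 0.
Proof.
by move=> H0 k0; rewrite (@lactE _ _ 0) ?big_ord0 // => l lk; apply: H0; lia.
Qed.

Lemma evz_neg f (l : int) : l < 0 -> evz f l = 0.
Proof. by case: l. Qed.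

Lemma evzB f g : fin_seq f -> fin_seq g -> evz (f - g) = evz f - evz g.
Proof.
move=> ff fg; apply/funext => -[k|k]; last by rewrite -[RHS]/(0 - 0) subr0.
rewrite -[RHS]/(evz f k - evz g k) /= -[X in _ - X]opprK opprK.
rewrite -[- isum _]scaleN1r -isumZ; last exact: fin_seq_weight.
rewrite -isumD; first 1 last.
- exact: fin_seq_weight.
- by apply: (fin_seq_weight (fun=> -1)); exact: fin_seq_weight.
congr isum; apply/funext => m; rewrite -[(f - g) m]/(f m - g m) scalerBr.
by rewrite -[RHS]/(_ *: f m + (-1) *: (_ *: g m)) scaleN1r.
Qed.

(** Since [e^((m + i) z) = e^(i z) e^(m z)], the substitution [x = e^z] turns multiplication by
    [p(x)] into multiplication by [p(e^z)]. *)
Lemma evz_pact p f : fin_seq f -> evz (pact p f) = lact (expcoef p) (evz f).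
Proof.
move=> ff; apply/funext => -[k|k]; last first.
  by rewrite lact_neg //; exact: evz_neg.
rewrite lact_nonneg; last exact: evz_neg.
pose F (i : nat) (j : nat) (m : int) : W :=
  (p`_i * expser i%:R j) *: (expser m%:~R (k - j) *: f m).
have fF i j : fin_seq (F i j) by do 2 apply: fin_seq_weight.
transitivity (\sum_(i < size p) \sum_(j < k.+1) isum (F i j)); last first.
  rewrite exchange_big; apply: eq_bigr => j _.
  rewrite /expcoef scaler_suml; apply: eq_bigr => i _.
  by rewrite /F isumZ //; exact: fin_seq_weight.
transitivity (\sum_(i < size p) isum (fun m : int => \sum_(j < k.+1) F i j m)); last first.
  by apply: eq_bigr => i _; rewrite isum_sum.
rewrite /= /pact.
transitivity (\sum_(i < size p)
  isum (fun m : int => expser m%:~R k *: (p`_i *: f (m - i%:Z)))); last first.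
  apply: eq_bigr => i _; rewrite -(isum_shift (i%:Z)); congr isum.
  apply/funext => m; rewrite addrK intrD expserD scaler_suml.
  by apply: eq_bigr => j _; rewrite /F !scalerA; congr (_ *: _); ring.
rewrite -isum_sum => [|i _].
  by congr isum; apply/funext => m; rewrite scaler_sumr.
apply: fin_seq_weight; apply: fin_seq_weight.
exact: (fin_seq_shift (- i%:Z)).
Qed.

Lemma scaler_tf (a : K) (v : W) : a *: v = 0 -> a = 0 \/ v = 0.
Proof. by move/eqP; rewrite scaler_eq0 => /orP[]/eqP; [left|right]. Qed.

(** Up to [k!], the coefficient of [z^k] is the sum of the [m^k f m]; the integers [m] are distinct
    nodes in characteristic 0, so [powers_indep] applies. *)
Lemma evz_eq0 f : fin_seq f -> evz f = 0 -> f = 0.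
Proof.
move=> [n fn] f0; apply/funext => m.
have [mn|mn] := ltnP n (absz m); first exact: fn.
have lt_m : (absz (m + n%:Z)%R < n.*2.+1)%N by lia.
pose x (i : 'I_n.*2.+1) : K := (i%:Z - n%:Z)%:~R.
have xI : injective x.
  move=> i j /intr_inj ij; apply: val_inj => /=; lia.
have := @powers_indep K W _ x (fun i => f (i%:Z - n%:Z)) scaler_tf xI _ (Ordinal lt_m).
rewrite /=; have -> : (absz (m + n%:Z)%R)%:Z - n%:Z = m by lia.
apply=> k; have := congr1 (fun F => F k%:Z) f0 => /=.
rewrite (@isumE _ _ n) => [|l /fn ->]; last by rewrite scaler0.
rewrite big_mkord => /(congr1 (fun v => k`!%:R *: v)).
rewrite -[(0 : int -> W) k]/0 scaler0 scaler_sumr => e.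
rewrite -[RHS]e; apply: eq_bigr => i _; rewrite scalerA /expser mulrCA mulfV ?mulr1 //.
by rewrite pnatr_eq0 -lt0n fact_gt0.
Qed.

Lemma evz_inj f g : fin_seq f -> fin_seq g -> evz f = evz g -> f = g.
Proof.
move=> ff fg e; apply/eqP; rewrite -subr_eq0; apply/eqP; apply: evz_eq0.
  exact: fin_seqB.
by rewrite evzB // e subrr.
Qed.

(** The series [x^c f(1 / x)] becomes [e^(c z) f(e^(- z))]. *)
Lemma evz_refl (c : int) f : fin_seq f ->
  evz (fun m => f (c - m)) = lact (expser c%:~R) (negz (evz f)).
Proof.
move=> ff; apply/funext => k.
have neg0 (l : int) : l < 0 -> negz (evz f) l = 0.
  by move=> l0; rewrite /negz evz_neg ?scaler0.
case: k => k; last by rewrite lact_neg.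
rewrite lact_nonneg //= -(isum_refl c).
transitivity (\sum_(i < k.+1) isum (fun m : int =>
    (expser c%:~R i * (-1) ^ (k - i)%N%:Z) *: (expser m%:~R (k - i)%N *: f m))); last first.
  apply: eq_bigr => i _; rewrite /negz /= scalerA isumZ //.
  exact: fin_seq_weight.
rewrite -isum_sum => [|i _]; last by do 2 apply: fin_seq_weight.
congr isum; apply/funext => m; rewrite subKr addrC intrD expserD scaler_suml.
apply: eq_bigr => i _; rewrite scalerA; congr (_ *: _); rewrite -mulrA; congr (_ * _).
by rewrite /expser mulrNz -[- m%:~R]mulN1r exprMn mulrA.
Qed.

End ExpSubst.

Section ExpCoef.
Variable K : numFieldType.
Implicit Types (p : {poly K}).

Lemma expcoefE n p k : (size p <= n)%N ->
  expcoef p k = \sum_(i < n) p`_i * expser i%:R k.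
Proof.
move=> pn; rewrite /expcoef (big_ord_widen n (fun i => p`_i * (i%:R ^+ k / k`!%:R))) //.
rewrite big_mkcond; apply: eq_bigr => i _; case: ltnP => // pi.
by rewrite nth_default // mul0r.
Qed.

(** The same node argument, now with the exponents of [p] as nodes. It allows [p(e^z)] to be
    cancelled by [lact_inj]. *)
Lemma expcoef_neq0 p : p != 0 -> exists k, expcoef p k != 0.
Proof.
move=> p0; apply: contrapT => np.
have {}np k : expcoef p k = 0.
  by apply/eqP; apply: contrapT => /negP nk; apply: np; exists k.
move/eqP: p0; apply; apply/polyP => i; rewrite coef0.
have [ip|/leq_sizeP->//] := ltnP i (size p).
have xI : injective (fun i : 'I_(size p) => i%:R : K).
  by move=> j l /eqP; rewrite eqr_nat => /eqP/val_inj.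
have := @powers_indep K K^o _ _ (fun i => p`_i) (@scaler_tf K K^o) xI _ (Ordinal ip).
apply=> k; have /(congr1 (fun v => v * k`!%:R)) := np k.
rewrite mul0r /expcoef mulr_suml => e; rewrite -[RHS]e; apply: eq_bigr => j _.
rewrite -mulrA divfK; first by rewrite -[LHS]/(_ * _) mulrC.
by rewrite pnatr_eq0 -lt0n fact_gt0.
Qed.

(** The factor [e^z - 1] has no constant term, so the term [i = k] is absent from the Cauchy
    product. *)
Lemma expcoefMXsub1 p k :
  expcoef (p * ('X - 1%:P)) k = \sum_(i < k) expcoef p i * expser 1 (k - i).
Proof.
have sz : (size (p * ('X - 1%:P))%R <= (size p).+1)%N.
  by rewrite (leq_trans (size_polyMleq _ _)) // size_XsubC addn2.
rewrite (expcoefE _ sz) mulrBr polyC1 mulr1.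
under eq_bigr => i _ do rewrite coefB mulrBl.
rewrite sumrB -(expcoefE _ (leqnSn _)) big_ord_recl coefMX eqxx mul0r add0r.
under eq_bigr => i _.
  rewrite coefMX /= /bump /= add1n -addn1 natrD addrC expserD mulr_sumr.
  over.
rewrite exchange_big big_ord_recr /= subnn.
have e10 : expser 1 0 = 1 :> K by rewrite /expser expr0 fact0 divr1.
rewrite [X in _ + X - _](_ : _ = expcoef p k) ?addrK; last first.
  by rewrite (expcoefE _ (leqnn _)); apply: eq_bigr => i _; rewrite e10 mulr1.
apply: eq_bigr => i _; rewrite (expcoefE _ (leqnn _)) mulr_suml.
by apply: eq_bigr => j _; rewrite mulrA.
Qed.

Lemma expcoef0 p : expcoef p 0 = p.[1].
Proof.
rewrite (expcoefE _ (leqnn _)) horner_coef; apply: eq_bigr => i _.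
by rewrite /expser !expr0 fact0 expr1n divr1.
Qed.

(** The polynomial [x^d p(1 / x)] with [d = (size p).-1], which replaces [p] under [x -> 1 / x]. *)
Definition polyrev p : {poly K} := \poly_(i < size p) p`_((size p).-1 - i).

Lemma expcoef_polyrev p :
  expcoef (polyrev p) = smul (expser ((size p).-1%:R)) (negzs (expcoef p)).
Proof.
apply/funext => k; rewrite (expcoefE _ (size_poly _ _)).
rewrite (reindex_inj rev_ord_inj) /=.
transitivity (\sum_(i < size p) \sum_(j < k.+1)
    p`_i * (expser (size p).-1%:R j * expser (- i%:R) (k - j))).
  apply: eq_bigr => i _; rewrite -mulr_sumr -expserD coef_poly.
  have ip := ltn_ord i; rewrite ifT; last by lia.
  have revK (n j : nat) : (j < n)%N -> (n.-1 - (n - j.+1))%N = j by lia.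
  have revE (n j : nat) : (j < n)%N -> (n - j.+1)%N = (n.-1 - j)%N by lia.
  have lerev (n j : nat) : (j < n)%N -> (j <= n.-1)%N by lia.
  by rewrite (revK _ _ ip) addrC -natrB ?(lerev _ _ ip) // (revE _ _ ip).
rewrite exchange_big; apply: eq_bigr => j _; rewrite /negzs (expcoefE _ (leqnn _)).
rewrite !mulr_sumr; apply: eq_bigr => i _.
rewrite /expser -[- i%:R]mulN1r exprMn; ring.
Qed.

Lemma polyrev0 p : p != 0 -> (polyrev p)`_0 != 0.
Proof.
move=> p0; rewrite coef_poly lt0n size_poly_eq0 p0 subn0.
by rewrite -lead_coefE lead_coef_eq0.
Qed.

Lemma pact_polyrev (W : lmodType K) p (a : int -> W) c m :
  pact (polyrev p) (fun m => a (c - m)) m = pact p a (c + (size p).-1%:Z - m).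
Proof.
rewrite (pactE _ _ (size_poly _ _)) (reindex_inj rev_ord_inj) /=.
apply: eq_bigr => i _; rewrite coef_poly; have ip := ltn_ord i; rewrite ifT; last by lia.
have revK (n j : nat) : (j < n)%N -> (n.-1 - (n - j.+1))%N = j by lia.
rewrite (revK _ _ ip); congr (_ *: a _); move: ip; move: (size p) (nat_of_ord i) => n j; lia.
Qed.

End ExpCoef.

(** * Poles and partial fractions *)

Section Poles.
Variables (K : numFieldType) (W : lmodType K).
Implicit Types (a b f : int -> W) (H : int -> W) (p : {poly K}).

Definition bounded_above a := exists N : int, forall m, N < m -> a m = 0.

Lemma fin_seq_bounded f : laurent f -> bounded_above f -> fin_seq f.
Proof.
case=> N fN [M fM]; exists (absz N + absz M)%N => m mn.
have [mN|mN] := ltrP m N; first exact: fN.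
by apply: fM; lia.
Qed.

Lemma bounded_above_pact p a : bounded_above a -> bounded_above (pact p a).
Proof.
case=> N aN; have [n pn] : exists n, (size p <= n)%N by exists (size p).
exists (N + n%:Z) => m mN; rewrite (pactE _ _ pn) big1 // => i _.
by rewrite aN ?scaler0 //; have := ltn_ord i; lia.
Qed.

Lemma bounded_aboveB a b : bounded_above a -> bounded_above b -> bounded_above (a - b).
Proof.
case=> N aN [M bM]; exists (Num.max N M) => m; rewrite gt_max => /andP[Nm Mm].
by rewrite -[LHS]/(a m - b m) aN ?bM ?subr0.
Qed.

(** On series bounded below, [p] acts as a power series and [lact_eq0] applies. Two-sided series do
    have torsion: [x - 1] kills the constant sequences. *)
Lemma laurent_pact_eq0 p a : p != 0 -> laurent a -> pact p a = 0 -> a = 0.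
Proof.
move=> p0 la pa0.
have p_lact : lact (fun i => p`_i) a = pact p a.
  have [N aN] := la; apply/funext => m.
  rewrite (@lactE _ _ (size p + (absz (m - N)).+1)) => [|l lm]; last by apply: aN; lia.
  by rewrite -pactE // leq_addr.
apply: (@lact_eq0 _ _ (fun i => p`_i)); rewrite ?p_lact //.
by exists (size p).-1; rewrite -lead_coefE lead_coef_eq0.
Qed.

(** [H] is the Laurent expansion at [z = 0] of [f(e^z)], for the rational function
    [f] with expansion [a] at infinity and [p f] a Laurent polynomial. *)
Definition expands a H p :=
  fin_seq (pact p a) /\ lact (expcoef p) H = evz (pact p a).

(** The two sides agree after multiplication by [p(e^z)], because [p] and [p'] commute, and this
    factor cancels. *)
Lemma expands_transfer a H p p' : laurent H -> p != 0 -> expands a H p ->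
  fin_seq (pact p' a) -> expands a H p'.
Proof.
move=> lH p0 [fp ep] fp'; split=> //.
apply: (lact_inj (lact_laurent _ lH) (evz_laurent _) (expcoef_neq0 p0)).
by rewrite lactC // ep -!evz_pact // pactCA.
Qed.

Lemma evz_at0 f : evz f 0 = isum f.
Proof.
by congr isum; apply/funext => m; rewrite /expser expr0 fact0 divr1 scale1r.
Qed.

(** Division by [x - 1] of a Laurent polynomial vanishing at 1: the sum of the coefficients of
    [(x - 1) g] telescopes. *)
Lemma fin_seq_XsubC1 g : bounded_above g -> fin_seq (pact ('X - 1%:P) g) ->
  evz (pact ('X - 1%:P) g) 0 = 0 -> fin_seq g.
Proof.
move=> [N gN] [n fn]; rewrite evz_at0 => s0; apply: fin_seq_bounded; last by exists N.
exists (- (n + absz N)%N%:Z - 1) => l ln.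
(* Chosen so that [- M - 1 = l]: over the window from [- M] to [M] the sum is [g l - g M], and
   [g M = 0] by boundedness above. *)
pose M := absz (l + 1).
have : isum (pact ('X - 1%:P) g) = g (- M%:Z - 1) - g M%:Z.
  rewrite (@isumE _ _ M) => [|m mM]; last by apply: fn; lia.
  transitivity (\sum_(0 <= i < M.*2.+1)
      ((fun i => - g (i%:Z - M%:Z - 1)) i.+1 - (fun i => - g (i%:Z - M%:Z - 1)) i)).
    apply: eq_bigr => i _; rewrite pact_XsubC scale1r opprK addrC.
    by congr (- g _ + g _); lia.
  rewrite telescope_sumr // opprK addrC.
  by congr (g _ - g _); lia.
rewrite s0 (gN M%:Z) ?subr0; last by lia.
by move=> ->; congr g; lia.
Qed.

(** The expansion at infinity of [alpha / (x - 1) + beta x / (x - 1)^2]. *)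
Definition polar (alpha beta : W) : int -> W :=
  fun m => if m < 0 then alpha - m%:~R *: beta else 0.

(** Clearing the double pole leaves [alpha (x - 1) + beta x]. *)
Lemma pact_polar (alpha beta : W) (m : int) :
  pact (('X - 1%:P) ^+ 2) (polar alpha beta) m =
    if m == 0 then - alpha else if m == 1 then alpha + beta else 0.
Proof.
have polar1 (l : int) : pact ('X - 1%:P) (polar alpha beta) l =
    if l < 0 then beta else if l == 0 then alpha + beta else 0.
  rewrite pact_XsubC scale1r /polar.
  have [l0|l0|->] := ltrgtP l 0.
  - rewrite ifT; last by lia.
    have -> : (l - 1)%:~R = l%:~R - 1 :> K by rewrite intrD.
    by rewrite scalerBl scale1r opprB addrCA addrK.
  - by rewrite ifF ?subr0 //; lia.
  - by rewrite subr0 sub0r scaleN1r opprK.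
rewrite expr2 pactM pact_XsubC scale1r !polar1.
have [->|m0] := eqVneq m 0; first by rewrite /= opprD addrCA subrr addr0.
have [->|m1] := eqVneq m 1; first by rewrite /= subr0.
have [m_lt0|m_ge0] := ltrP m 0; first by rewrite ifT ?subrr //; lia.
by rewrite ifF ?ifF ?ifF ?subr0 //; lia.
Qed.

End Poles.

(** * Poles of order at most two at [x = 1] *)

Section SimplePole.
Variables (K : numFieldType) (W : lmodType K).
Implicit Types (a : int -> W) (H : int -> W) (p : {poly K}).

(** Read off from [e^z - 1 = z + z^2 / 2 + z^3 / 6 + ...]. *)
Lemma expcoefMXsub1_small p :
  [/\ expcoef (p * ('X - 1%:P)) 0 = 0,
      expcoef (p * ('X - 1%:P)) 1 = expcoef p 0,
      expcoef (p * ('X - 1%:P)) 2 = expcoef p 0 / 2 + expcoef p 1 &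
      expcoef (p * ('X - 1%:P)) 3 = expcoef p 0 / 6 + expcoef p 1 / 2 + expcoef p 2].
Proof.
split; rewrite expcoefMXsub1 ?big_ord0 // ?big_ord_recl ?big_ord0 /expser /bump /=;
  by rewrite ?expr1n ?addr0 ?div1r ?invr1 ?mulr1 ?addrA.
Qed.

(** At [x = e^z] the function [x / (x - 1)^2] is [z^-2] plus a regular part, with no [z^-1] term,
    and [1 / (x - 1)] is [z^-1] plus a regular part. So [polar] with the coefficients of [z^-1] and
    [z^-2] in [H] is exactly what must be removed to make [x = 1] a regular point. *)
Lemma fin_seq_pole_polar a H p : bounded_above a ->
    (forall l : int, l < - 2 -> H l = 0) -> p != 0 -> expands a H p ->
  exists p1 : {poly K}, p1.[1] != 0 /\ fin_seq (pact p1 (a - polar (H (- 1)) (H (- 2)))).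
Proof.
move=> aN H2 p0 exp_p.
have lH : laurent H by exists (- 2).
have transfer := expands_transfer lH p0 exp_p.
have [e [p1]] := multiplicity_XsubC p 1; rewrite p0 /= => p1_1 def_p.
exists p1; split=> //.
have lact0 s : lact s H 0 = s 0%N *: H 0 + s 1%N *: H (- 1) + s 2%N *: H (- 2).
  rewrite (@lactE _ _ 3) => [|l l3]; last by apply: H2; lia.
  by rewrite !big_ord_recl big_ord0 !addr0 !addrA.
have lact1 s : lact s H 1 =
    s 0%N *: H 1 + s 1%N *: H 0 + s 2%N *: H (- 1) + s 3%N *: H (- 2).
  rewrite (@lactE _ _ 4) => [|l l3]; last by apply: H2; lia.
  by rewrite !big_ord_recl big_ord0 !addr0 !addrA.
(* The multiplicity [e] of the root 1 of [p] is brought to 2: multiply when it is smaller, divide by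
   [x - 1] one factor at a time when it is larger. *)
have fin2 : fin_seq (pact (p1 * ('X - 1%:P) * ('X - 1%:P)) a).
  have {exp_p} [fp _] := exp_p; rewrite def_p in fp; elim: e fp {def_p} => [|e IHe] fp.
    rewrite expr0 mulr1 in fp.
    by rewrite mulrC pactM; apply: fin_pact; rewrite mulrC pactM; apply: fin_pact.
  case: e => [|[|e]] in IHe fp.
  - by rewrite mulrC pactM; apply: fin_pact; rewrite expr1 in fp.
  - by rewrite expr2 mulrA in fp.
  apply: IHe; set p2 := p1 * _.
  have def_fp : p1 * ('X - 1%:P) ^+ e.+3 = ('X - 1%:P) * p2 by rewrite exprS mulrCA.
  have [_ ep] := transfer _ fp; rewrite def_fp pactM in fp ep.
  apply: fin_seq_XsubC1 fp _; first exact: bounded_above_pact.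
  (* The value at [z = 0] involves only the first three coefficients of the multiplier; a triple
     zero at [z = 0] kills them all. *)
  rewrite -ep lact0 mulrC /p2 2!exprSr !mulrA.
  set p3 := p1 * _; set p4 := p3 * _; set p5 := p4 * _.
  have [-> -> -> _] := expcoefMXsub1_small p5.
  have [-> -> _ _] := expcoefMXsub1_small p4.
  have [-> _ _ _] := expcoefMXsub1_small p3.
  by rewrite mul0r addr0 !scale0r !addr0.
set r := p1 * _ in fin2; set a0 := a - _.
have fpol : fin_seq (pact (('X - 1%:P) ^+ 2) (polar (H (- 1)) (H (- 2)))).
  by exists 1%N => m m1; rewrite pact_polar ifF ?ifF //; lia.
have ev_pol k : (k <= 1)%N -> evz (pact (('X - 1%:P) ^+ 2) (polar (H (- 1)) (H (- 2)))) k%:Z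
    = if k == 0%N then H (- 2) else H (- 1) + H (- 2).
  move=> k1; rewrite /= (@isumE _ _ 1) => [|m m1]; last first.
    by rewrite pact_polar ifF ?ifF ?scaler0 //; lia.
  rewrite 3?big_ltn // big_geq // !pact_polar /= scaler0 add0r addr0.
  case: k k1 => [|[|//]] _.
    by rewrite /expser !expr0 fact0 divr1 !scale1r addKr.
  rewrite subrr (_ : 2%:Z - 1%:Z = 1) // /expser expr0n mul0r scale0r add0r.
  by rewrite expr1n divr1 scale1r.
have def_fpol : pact (r * ('X - 1%:P)) (polar (H (- 1)) (H (- 2))) =
    pact p1 (pact (('X - 1%:P) ^+ 2) (polar (H (- 1)) (H (- 2)))).
  by rewrite /r -mulrA -expr2 pactM.
have fin_h : fin_seq (pact (r * ('X - 1%:P)) a0).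
  by rewrite pactBr; apply: fin_seqB => //; rewrite def_fpol; exact: fin_pact.
have [r0 r1 r2 _] := expcoefMXsub1_small p1.
have [t0 t1 t2 t3] := expcoefMXsub1_small r.
have evh k : evz (pact (r * ('X - 1%:P)) a0) k = lact (expcoef (r * ('X - 1%:P))) H k
    - lact (expcoef p1) (evz (pact (('X - 1%:P) ^+ 2) (polar (H (- 1)) (H (- 2))))) k.
  rewrite pactBr evzB //; last by rewrite def_fpol; exact: fin_pact.
  by have [_ <-] := transfer _ fin2; rewrite def_fpol evz_pact.
(* The constant and linear coefficients in [z] vanish, so that both remaining factors [x - 1] can be
   divided out. *)
have evh0 : evz (pact (r * ('X - 1%:P)) a0) 0 = 0.
  rewrite evh lact0 lact_nonneg ?big_ord_recl ?big_ord0; last exact: evz_neg.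
  rewrite ev_pol // t0 t1 t2 r0 r1 mul0r add0r !scale0r !add0r addr0.
  by rewrite subrr.
have evh1 : evz (pact (r * ('X - 1%:P)) a0) 1 = 0.
  rewrite evh lact1 lact_nonneg ?big_ord_recl ?big_ord0; last exact: evz_neg.
  rewrite !ev_pol // /bump /= t0 t1 t2 t3 r0 r1 r2 mul0r !add0r !scale0r !add0r addr0.
  have -> : 0 / 6 + expcoef p1 0 / 2 + (expcoef p1 0 / 2 + expcoef p1 1) =
    expcoef p1 0 + expcoef p1 1 by field.
  by rewrite scalerDr scalerDl addrA subrr.
have bd_a0 : bounded_above a0.
  by apply: bounded_aboveB => //; exists 0 => m m0; rewrite /polar ifF //; lia.
have bd_r : bounded_above (pact r a0) by exact: bounded_above_pact.
rewrite mulrC pactM in fin_h evh0 evh1.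
have fin_r : fin_seq (pact r a0) by exact: fin_seq_XsubC1 fin_h evh0.
(* As [e^z - 1 = z + ...], the linear coefficient before the first division is the constant
   coefficient after it. *)
move: evh1; rewrite evz_pact // lact_nonneg; last exact: evz_neg.
have [x0 x1 _ _] := expcoefMXsub1_small 1.
rewrite mul1r in x0 x1.
rewrite 2!big_ord_recl big_ord0 addr0 x0 x1 expcoef0 hornerE scale0r add0r scale1r.
have def_r : pact r a0 = pact ('X - 1%:P) (pact p1 a0) by rewrite /r mulrC pactM.
rewrite def_r in fin_r *; apply: fin_seq_XsubC1 fin_r; exact: bounded_above_pact.
Qed.

End SimplePole.

(** * Rescaling of the variable *)

Section Twist.
Variables (K : fieldType) (W : lmodType K).
Implicit Types (a b : int -> W) (p : {poly K}) (c : K).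

(** [x |-> c x] on series, resp. [x |-> x / c] on polynomials. *)
Definition twist c a : int -> W := fun m => c ^ m *: a m.
Definition polydil c p : {poly K} := \poly_(i < size p) (p`_i * c ^- i).

Lemma twistB c a b : twist c (a - b) = twist c a - twist c b.
Proof. by apply/funext => m; rewrite -[RHS]/(twist c a m - twist c b m) /twist scalerBr. Qed.

Lemma twistK c a : c != 0 -> twist c (twist c^-1 a) = a.
Proof.
move=> c0; apply/funext => m; rewrite /twist scalerA -expfzMl mulfV //.
by rewrite exp1rz scale1r.
Qed.

Lemma twistVK c a : c != 0 -> twist c^-1 (twist c a) = a.
Proof. by move=> c0; rewrite -{2}[c]invrK twistK // invr_eq0. Qed.

(** With [y = c x], the series [p(x) a(c x)] is [p(y / c) a(y)]. *)
Lemma pact_twist c p a : c != 0 -> pact p (twist c a) = twist c (pact (polydil c p) a).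
Proof.
move=> c0; apply/funext => m; rewrite /twist (pactE _ _ (size_poly _ _)) scaler_sumr.
apply: eq_bigr => i _; rewrite coef_poly ltn_ord !scalerA; congr (_ *: _).
by rewrite mulrCA expfzDr //; congr (_ * (_ * _)); rewrite exprnN.
Qed.

Lemma horner_polydil c p x : (polydil c p).[x] = p.[x / c].
Proof.
rewrite horner_poly horner_coef; apply: eq_bigr => i _.
by rewrite exprMn exprVn mulrAC mulrA.
Qed.

Lemma polydil_eq0 c p : c != 0 -> (polydil c p == 0) = (p == 0).
Proof.
move=> c0; apply/eqP/eqP => [/polyP p0|->]; last first.
  by apply/polyP => i; rewrite coef_poly size_poly0 coef0.
apply/polyP => i; have := p0 i; rewrite coef_poly !coef0.
case: ltnP => [_ /eqP|/leq_sizeP-> //].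
by rewrite mulf_eq0 invr_eq0 expf_eq0 (negPf c0) andbF orbF => /eqP.
Qed.

Lemma fin_seq_twist c a : fin_seq a -> fin_seq (twist c a).
Proof. exact: fin_seq_weight. Qed.

Lemma fin_seq_pact_dil c p a : c != 0 ->
  fin_seq (pact p (twist c a)) -> fin_seq (pact (polydil c p) a).
Proof.
move=> c0 /(fin_seq_twist c^-1); rewrite pact_twist //.
by rewrite twistVK.
Qed.

End Twist.

(** The product of the denominators is a common denominator for the sum. The property [Q] is
    abstract because this serves both for being a Laurent polynomial and for being 0. *)
Lemma pact_prod_sum (K : comNzRingType) (W : lmodType K) (Q : (int -> W) -> Prop)
    (I : Type) (r : seq I) (P : pred I) (E : I -> {poly K}) (t : I -> int -> W) :
    Q 0 -> (forall a b, Q a -> Q b -> Q (a + b)) -> (forall p a, Q a -> Q (pact p a)) ->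
    (forall i, P i -> Q (pact (E i) (t i))) ->
  Q (pact (\prod_(i <- r | P i) E i) (\sum_(i <- r | P i) t i)).
Proof.
move=> Q0 QD Qp Qt; elim/big_rec2: _ => [|i a p Pi Qpa]; first by rewrite pact0r.
rewrite pactDr; apply: QD; first by rewrite mulrC pactM; apply/Qp/Qt.
by rewrite pactM; apply: Qp.
Qed.

Section PartialFractions.
Variables (K : numClosedFieldType) (W : lmodType K).
Implicit Types (a b : int -> W) (p : {poly K}).

(** The polynomials [p] with [pact p a] finite form an ideal without common zero. *)
Lemma fin_seq_of_no_pole a :
  (forall x, exists p, p.[x] != 0 /\ fin_seq (pact p a)) -> fin_seq a.
Proof.
move=> np; pose D n := `[< exists p, [/\ p != 0, size p = n & fin_seq (pact p a)] >].
have exD : exists n, D n.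
  have [p [p0 fp]] := np 0; exists (size p); apply/asboolP; exists p; split=> //.
  by apply: contraNneq p0 => ->; rewrite horner0.
case: (ex_minnP exD) => n /asboolP[d [d0 dn fd]] nmin.
have dvd p : fin_seq (pact p a) -> d %| p.
  move=> fp; apply/modp_eq0P; apply: contrapT => /eqP pd0.
  suff /nmin : D (size (p %% d)) by rewrite -dn leqNgt ltn_modp d0.
  apply/asboolP; exists (p %% d); split=> //.
  have -> : p %% d = p + - (p %/ d) * d by rewrite {2}(divp_eq p d) mulNr addrC addKr.
  rewrite pactDl; apply: fin_seqD => //.
  by rewrite pactM; exact: fin_pact.
have [[x dx]|] := altP (closed_rootP d).
  have [p [px /dvd/dvdpP[e def_p]]] := np x.
  by rewrite def_p hornerM (rootP dx) mulr0 eqxx in px.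
rewrite negbK => /size_poly1P[c c0 def_d]; move: fd; rewrite def_d pactC => fd.
have -> : a = (fun m => c^-1 *: (c *: a) m).
  by apply/funext => m; rewrite -[(c *: a) m]/(c *: a m) scalerA mulVf // scale1r.
exact: fin_seq_weight.
Qed.

(** Subtracting the polar parts at the [q ^ k] from [a] leaves a Laurent polynomial, so [a - b] is
    the sum over the poles of the difference between the expansions at infinity and at 0 of each
    polar part. *)
Lemma partial_fractions (q : K) (ks : seq int) a b (P P1 : {poly K})
    (alpha beta : int -> W) :
    q != 0 -> (forall n : nat, (0 < n)%N -> q ^+ n != 1) -> uniq ks ->
    bounded_above a -> laurent b -> P != 0 -> pact P a = pact P b ->
    P1 != 0 -> fin_seq (pact P1 a) -> (forall x, root P1 x -> exists k : int, x = q ^ k) ->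
    (forall k, k \notin ks -> alpha k = 0 /\ beta k = 0) ->
    (forall k, exists p, p.[1] != 0 /\
       fin_seq (pact p (twist (q ^ k) a - polar (alpha k) (beta k)))) ->
  forall m, a m - b m =
    \sum_(k <- ks) (q ^ k)^-1 ^ m *: (alpha k - m%:~R *: beta k).
Proof.
move=> q0 qnr uks a_bd b_l P0 PaPb P10 fP1 rP1 ks0 poles m0.
have qk0 k : q ^ k != 0 by rewrite expfz_neq0.
(* The candidate poles [q ^ k] are pairwise distinct because [q] is not a root of unity. *)
have qI j k : q ^ j = q ^ k -> j = k.
  wlog jk : j k / j <= k => [th|] e.
    by have [/th->//|/ltW/th/(_ (esym e))] := lerP j k.
  have e1 : q ^ (k - j) = 1 by rewrite expfzDr // -e -expfzDr // subrr.
  have [->//|kj] := eqVneq j k.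
  have := qnr (absz (k - j)); rewrite exprnP; have -> : (absz (k - j))%:Z = k - j by lia.
  by rewrite e1 eqxx; lia.
pose t k := twist (q ^ k)^-1 (polar (alpha k) (beta k)).
pose E k := polydil (q ^ k) (('X - 1%:P) ^+ 2).
have tK k : twist (q ^ k) (t k) = polar (alpha k) (beta k) by rewrite twistK.
have E0 k : E k != 0 by rewrite polydil_eq0 // expf_eq0 polyXsubC_eq0.
have Ex k x : ((E k).[x] == 0) = (x == q ^ k).
  rewrite horner_polydil horner_exp hornerXsubC expf_eq0 /= subr_eq0.
  by rewrite -(inj_eq (mulIf (qk0 k))) divfK // mul1r.
have fE k : fin_seq (pact (E k) (t k)).
  apply: fin_seq_pact_dil => //; rewrite tK.
  by exists 1%N => m m1; rewrite pact_polar ifF ?ifF //; lia.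
have fEt (Q : pred int) : fin_seq (pact (\prod_(k <- ks | Q k) E k) (\sum_(k <- ks | Q k) t k)).
  apply: pact_prod_sum => // [|f g|p f].
  - exact: fin_seq0.
  - exact: fin_seqD.
  - exact: fin_pact.
have t0 k : k \notin ks -> t k = 0.
  move/ks0 => [ak bk]; apply/funext => m; rewrite /t /twist /polar ak bk.
  by case: ifP => _; rewrite ?scaler0 ?subr0 ?scaler0.
(* Checked point by point: at [q ^ j] the polar part of index [j] removes the pole, and any other
   point is not a root of [P1]. *)
have fin_a : fin_seq (a - \sum_(k <- ks) t k).
  apply: fin_seq_of_no_pole => x.
  have [[j xj]|nx] := pselect (exists j, x = q ^ j).
    have [p [p1 fp]] := poles j.
    have ft : fin_seq (pact (polydil (q ^ j) p) (a - t j)).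
      by apply: fin_seq_pact_dil => //; rewrite twistB tK.
    exists (polydil (q ^ j) p * \prod_(k <- ks | k != j) E k); split.
      rewrite hornerM horner_polydil xj mulfV // mulf_neq0 // horner_prod.
      rewrite prodf_seq_neq0; apply/allP => k _; apply/implyP => kj.
      by rewrite Ex; apply: contra kj => /eqP/qI->.
    have -> : \sum_(k <- ks) t k = t j + \sum_(k <- ks | k != j) t k.
      have [jks|jks] := boolP (j \in ks); first by rewrite (bigD1_seq j).
      rewrite t0 // add0r big_seq [RHS]big_seq_cond; apply: eq_bigl => k.
      by case: eqVneq => [->|]; rewrite ?(negPf jks) // andbT.
    rewrite opprD addrA pactBr; apply: fin_seqB.
      by rewrite mulrC pactM; exact: fin_pact.
    by rewrite pactM; exact: fin_pact.
  exists (P1 * \prod_(k <- ks) E k); split.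
    rewrite hornerM mulf_neq0 //.
      by apply/negP => /rP1 [k xk]; apply: nx; exists k.
    rewrite horner_prod prodf_seq_neq0; apply/allP => k _; apply/implyP => _.
    by rewrite Ex; apply/eqP => xk; apply: nx; exists k.
  rewrite pactBr; apply: fin_seqB.
    by rewrite mulrC pactM; exact: fin_pact.
  by rewrite pactM; exact: fin_pact.
(* The formula for [t k] without its cutoff [m < 0]: expansion at infinity minus expansion at 0. *)
pose full k m := (q ^ k)^-1 ^ m *: (alpha k - m%:~R *: beta k).
(* After rescaling, [full k] is affine in [m], and [(x - 1)^2] takes second differences. *)
have Efull k : pact (E k) (full k) = 0.
  suff e : pact (('X - 1%:P) ^+ 2) (twist (q ^ k) (full k)) = 0.
    rewrite -[LHS](twistVK _ (qk0 k)) -pact_twist // e.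
    by apply/funext => m; rewrite /twist scaler0.
  have -> : twist (q ^ k) (full k) = fun m => alpha k - m%:~R *: beta k by exact: twistK.
  apply/funext => m; rewrite expr2 pactM !pact_XsubC !scale1r.
  have -> : (m - 1 - 1)%:~R = m%:~R - 1 - 1 :> K by rewrite !intrD.
  have -> : (m - 1)%:~R = m%:~R - 1 :> K by rewrite intrD.
  rewrite !scalerBl !scale1r; set u := m%:~R *: beta k.
  have diff (v y : W) : v - (y - beta k) - (v - y) = beta k.
    by rewrite !opprB !addrA subrK addrC addKr.
  by rewrite !diff subrr.
pose c := a - b - \sum_(k <- ks) full k.
suff c0 : c = 0.
  have := congr1 (fun f => f m0) c0.
  rewrite -[c m0]/(a m0 - b m0 - (\sum_(k <- ks) full k) m0) fct_sumE.
  by move/eqP; rewrite subr_eq0 => /eqP.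
(* It remains to see that [c] is bounded below and torsion. Far to the left [b] vanishes, [a] is the
   sum of the [t k], and [t k] agrees with [full k]. *)
apply: (@laurent_pact_eq0 _ _ (P * \prod_(k <- ks) E k)).
- by rewrite mulf_neq0 // prodf_seq_neq0; apply/allP => k _; rewrite E0.
- have [n fn] := fin_a; have [N bN] := b_l.
  exists (Num.min (- n%:Z - 1) (Num.min N (-1))) => m; rewrite !lt_min => /and3P[mn mN m1].
  have := fn m; rewrite -[c m]/(a m - b m - (\sum_(k <- ks) full k) m) bN // subr0.
  rewrite -[(a - _) m]/(a m - (\sum_(k <- ks) t k) m) !fct_sumE => e.
  rewrite -[RHS]e; last by lia.
  congr (_ - _); apply: eq_bigr => k _; rewrite /full /t /twist /polar ifT //; lia.
- rewrite pactBr mulrC pactM pactBr PaPb subrr pact0r sub0r.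
  rewrite mulrC pactM.
  suff -> : pact (\prod_(k <- ks) E k) (\sum_(k <- ks) full k) = 0 by rewrite pact0r oppr0.
  apply: (@pact_prod_sum _ _ (fun f => f = 0)) => // [f g -> ->|p f ->].
    by rewrite addr0.
  by rewrite pact0r.
Qed.

End PartialFractions.

Lemma expser0 (K : numFieldType) k : expser 0 k = (k == 0%N)%:R :> K.
Proof.
by case: k => [|k]; rewrite /expser ?expr0 ?fact0 ?divr1 // expr0n mul0r.
Qed.

Lemma lact_exp0 (K : numFieldType) (W : lmodType K) (H : int -> W) : lact (expser 0) H = H.
Proof.
apply/funext => k; rewrite /lact (fsbigTE [fset 0%N]%fset) => [|i].
  by rewrite big_seq_fset1 expser0 scale1r subr0.
by rewrite inE expser0 => /negPf ->; rewrite scale0r.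
Qed.

(** * Skew symmetry and the commutator formula *)

Section Skew.
Variables (K : numFieldType) (V : lmodType K) (Y : vertex_algebra V).

Lemma vmode0l n v : Y 0 n v = 0.
Proof. exact: linear_map0 (vmode_linearl Y n v). Qed.

Lemma vmode0r u n : Y u n 0 = 0.
Proof. exact: linear_map0 (vmode_linearr Y u n). Qed.

Lemma binomz0 m : binomz K m 0 = 1.
Proof. by rewrite /binomz big_ord0 fact0 divr1. Qed.

Lemma binomzN1 i : binomz K (- 1) i = (- 1) ^+ i.
Proof.
rewrite /binomz; apply: (canLR (mulfK _)); first by rewrite pnatr_eq0 -lt0n fact_gt0.
elim: i => [|i IHi]; first by rewrite big_ord0 fact0 expr0 mulr1.
have -> : (- 1) ^+ i.+1 * i.+1`!%:R = (- 1) ^+ i * i`!%:R * - (i.+1%:R) :> K.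
  by rewrite factS exprSr natrM; ring.
by rewrite big_ord_recr /= IHi (_ : - 1 - i%:Z = - i.+1%:Z) ?mulrNz //; lia.
Qed.

(** Jacobi identity on the vacuum with [m = - 1] and [n = 0]: by creation only
    [v_l (u_(-1) 1) = v_l u] survives on the right, and the binomials on the left are signs. *)
Lemma vmode_skew n u v (l : int) : (forall i : nat, (n <= i)%N -> Y u (l + i%:Z) v = 0) ->
  Y v l u = - \sum_(i < n) (- 1) ^ (l + i%:Z) *: Y (Y u (l + i%:Z) v) (- 1 - i%:Z) (vac Y).
Proof.
move=> un; have := vmode_jacobi Y u v (vac Y) l (- 1) 0.
rewrite [RHS](fsbigTE [fset 0%N]%fset) => [|i]; last first.
  rewrite inE => i0; rewrite !vmode_creation0 ?vmode0r ?scaler0 ?subrr ?scaler0 //.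
  by case: i i0.
rewrite big_seq_fset1 expr0 binomz0 mulr1 scale1r.
have -> : l + 0 - 0%:Z = l by lia.
rewrite vmode_creation0 // vmode0r sub0r (_ : - 1 + 0%:Z = - 1) // vmode_creation.
rewrite (@fsbigE _ _ _ _ _ (index_iota 0 n)); first last.
- move=> i _; rewrite mem_index_iota /= -leqNgt => ni.
  by rewrite un // vmode0l scaler0.
- by [].
- exact: iota_uniq.
rewrite (eq_bigl predT) => [|i]; last by apply/mem_set.
rewrite big_mkord => /(congr1 (fun x => - ((- 1) ^ l *: x))) /=.
rewrite scalerN opprK scalerA -expfzMl mulN1r opprK exp1rz scale1r => <-.
congr (- _); rewrite scaler_sumr; apply: eq_bigr => i _.
rewrite scalerA binomzN1 (_ : - 1 + 0 - i%:Z = - 1 - i%:Z) ?addr0 //; congr (_ *: _).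
by rewrite exprnP -expfzDr // oppr_eq0 oner_eq0.
Qed.

End Skew.

Section Quasi.
Variables (K : numFieldType) (V : lmodType K) (Y : vertex_algebra V).
Variables (W : lmodType K) (YW : V -> W -> int -> W).
Hypothesis module : phi_quasi_module Y YW.
Implicit Types (u v : V) (w : W) (N : int) (p : {poly K}).

(** The part of [Y_W(u, x1) Y_W(v, x2) w] of total degree [N], as a series in [x1 / x2]. *)
Definition homog u v w N : int -> W := fun m => YW2 YW u v w m (N - m).

(** The coefficient of [x2^N] in [Y_W(Y(u, z) v, x2) w], as a series in [z]. *)
Definition iterate u v w N : int -> W := fun k => YW (Y u (- k - 1) v) w N.

Lemma YW0l w n : YW 0 w n = 0.
Proof. by have [lin _ _ _ _] := module; exact: linear_map0 (lin w n). Qed.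

Lemma YW0r v n : YW v 0 n = 0.
Proof. by have [_ lin _ _ _] := module; exact: linear_map0 (lin v n). Qed.

Lemma iterate_laurent u v w N : laurent (iterate u v w N).
Proof.
have [M uM] := vmode_trunc Y u v; exists (- M) => k kM.
by rewrite /iterate uM ?YW0l //; lia.
Qed.

Lemma homog_bounded_above u v w N : bounded_above (homog u v w N).
Proof.
have [_ _ /(_ v w)[M vM] _ _] := module.
by exists (N - M) => m mM; rewrite /homog /YW2 vM ?YW0r //; lia.
Qed.

Lemma ratio_mul_homog p u v w N m :
  ratio_mul p (YW2 YW u v w) m (N - m) = pact p (homog u v w N) m.
Proof.
by apply: eq_bigr => i _; rewrite /homog; congr (_ *: YW2 _ _ _ _ _ _); rewrite opprB addrA addrAC.
Qed.

Lemma quasi_compatible_fin p u v w N :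
  quasi_compatible YW p u v -> fin_seq (pact p (homog u v w N)).
Proof.
move=> /(_ w)[M pM]; exists (absz M + absz N)%N => m mM.
by rewrite -ratio_mul_homog pM //; lia.
Qed.

(** In a fixed total degree [N], substituting [x1 = x2 e^z] amounts to setting [x1 / x2 = e^z]. One
    [p] serves all [w] and [N]. *)
Lemma module_expands u v :
  exists p, p != 0 /\ forall w N, expands (homog u v w N) (iterate u v w N) p.
Proof.
have [_ _ _ _ /(_ u v)[p [p0 pc pe]]] := module; exists p; split=> // w N.
split; first exact: quasi_compatible_fin.
apply/funext => k; transitivity (exp_mul_iterate Y YW p u v w k N).
  rewrite /lact /exp_mul_iterate /iterate; apply: eq_fsbigr => i _.
  by congr (_ *: YW (Y _ _ _) _ _); rewrite opprB.
rewrite pe; case: k => k //=; rewrite /isum /expser; apply: eq_fsbigr => m _.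
by rewrite ratio_mul_homog.
Qed.

(** Weak associativity for [v] and the vacuum: the product has the single term [m = N], so after
    cancelling [p] the iterate is [e^(N z)] times the coefficient of [Y_W(v, x) w]. *)
Lemma YW_exp v w N (i : nat) :
  YW (Y v (- 1 - i%:Z) (vac Y)) w N = expser N%:~R i *: YW v w N.
Proof.
have [p [p0 /(_ w N)[fp ep]]] := module_expands v (vac Y).
have aE m : homog v (vac Y) w N m = if m == N then YW v w N else 0.
  have [_ _ _ YWvac _] := module; rewrite /homog /YW2 YWvac subr_eq0 eq_sym.
  by case: eqP => [->//|_]; rewrite YW0r.
have fa : fin_seq (homog v (vac Y) w N).
  by exists (absz N) => m mN; rewrite aE ifF //; lia.
have : iterate v (vac Y) w N = evz (homog v (vac Y) w N).
  apply: (lact_inj (iterate_laurent _ _ _ _) (evz_laurent _) (expcoef_neq0 p0)).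
  by rewrite ep evz_pact.
move/(congr1 (fun f => f i%:Z)); rewrite /iterate /= addrC => ->.
rewrite /isum (fsbigTE [fset N]%fset) => [|m]; first by rewrite big_seq_fset1 aE eqxx.
by rewrite inE aE => /negPf ->; rewrite scaler0.
Qed.

Lemma YW_sum I (r : seq I) (c : I -> K) (x : I -> V) w N :
  YW (- \sum_(i <- r) c i *: x i) w N = - \sum_(i <- r) c i *: YW (x i) w N.
Proof.
have [lin _ _ _ _] := module.
rewrite (linear_mapN _ (lin w N)); congr (- _); elim/big_rec2: _ => [|i y z _ <-]; first exact: YW0l.
by rewrite lin.
Qed.

(* Skew symmetry [Y(v, z) u = e^(zD) Y(u, - z) v], with [D] acting as [x d/dx]. *)
Lemma iterate_skew u v w N :
  iterate u v w N = lact (expser N%:~R) (negz (iterate v u w N)).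
Proof.
have lH := iterate_laurent u v w N.
(* The exponential is moved to the other side because [vmode_skew] expands [v_l u] in the modes of
   [u] on [v]. *)
suff -> : negz (iterate v u w N) = lact (expser (- N%:~R)) (iterate u v w N).
  by rewrite -lactA // smul_exp addNr lact_exp0.
apply/funext => k; have [M uM] := vmode_trunc Y u v.
rewrite (@lactE _ _ (absz (M + k)%R + 2)%N) => [|l lk]; last first.
  by rewrite /iterate uM ?YW0l //; lia.
rewrite /negz /iterate (@vmode_skew _ _ _ (absz (M + k)%R + 2)%N u) => [|i ki]; last first.
  by apply: uM; lia.
rewrite YW_sum -sumrN scaler_sumr; apply: eq_bigr => i _.
have -> : - (k - i%:Z) - 1 = - k - 1 + i%:Z by lia.
rewrite YW_exp scalerN -scaleNr !scalerA; congr (_ *: _).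
have sgn : - ((- 1) ^ k * (- 1) ^ (- k - 1 + i%:Z)) = (- 1) ^+ i :> K.
  rewrite -expfzDr ?oppr_eq0 ?oner_eq0 // (_ : k + _ = i%:Z - 1); last by lia.
  by rewrite expfzDr ?oppr_eq0 ?oner_eq0 // exprN1 invrN invr1 mulrN1 opprK.
rewrite -[in RHS]mulN1r /expser exprMn -sgn; ring.
Qed.

(** Exchanging the operators inverts the ratio [x = x1 / x2], that is [z] becomes [- z]; skew
    symmetry turns the iterate of [v] and [u] into that of [u] and [v]. *)
Lemma expands_opposite u v w N p :
    expands (homog v u w N) (iterate v u w N) p ->
  expands (fun m => YW v (YW u w m) (N - m)) (iterate u v w N) (polyrev p).
Proof.
move=> [fp ep].
have -> : (fun m => YW v (YW u w m) (N - m)) = (fun m => homog v u w N (N - m)).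
  by apply/funext => m; rewrite /homog /YW2 subKr.
have def_b : pact (polyrev p) (fun m => homog v u w N (N - m)) =
    (fun m => pact p (homog v u w N) (N + (size p).-1%:Z - m)).
  by apply/funext => m; rewrite pact_polyrev.
have lH := iterate_laurent v u w N; have lnH := negz_laurent lH.
split; rewrite def_b; first exact: fin_seq_refl.
rewrite evz_refl // -ep negz_lact // iterate_skew expcoef_polyrev.
rewrite lactA; last exact: lact_laurent.
rewrite (lactC (negzs _)) // -lactA ?smul_exp; last exact: lact_laurent.
by rewrite intrD.
Qed.

(** Both orders of the product have the same iterate. Times a common denominator they are Laurent
    polynomials with equal images under [x = e^z], and [evz] is injective. *)
Lemma quasi_locality u v w N : exists P : {poly K}, P != 0 /\
  pact P (homog u v w N) = pact P (fun m => YW v (YW u w m) (N - m)).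
Proof.
have [p [p0 /(_ w N) ep]] := module_expands u v.
have [p' [p'0 /(_ w N) ep']] := module_expands v u.
have {ep'} := expands_opposite ep'; set p'' := polyrev p' => -[fb eb].
case: ep => fa ea; have lH := iterate_laurent u v w N.
exists (p'' * p); split.
  rewrite mulf_neq0 //; apply: contraTneq (polyrev0 p'0) => e; rewrite -/p'' e.
  by rewrite coef0 eqxx.
rewrite pactM [in RHS]mulrC [in RHS]pactM; apply: evz_inj; [exact: fin_pact..|].
by rewrite (evz_pact _ fa) (evz_pact _ fb) -ea -eb lactC.
Qed.

End Quasi.

Section Commutator.
Variables (K : numClosedFieldType) (V : lmodType K) (Y : vertex_algebra V).
Variables (W : lmodType K) (YW : V -> W -> int -> W).
Variables (q : K) (sigma : int -> V -> V).
Hypothesis q_neq0 : q != 0.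
Hypothesis q_nonroot : forall n : nat, (0 < n)%N -> q ^+ n != 1.
Hypothesis module : equivariant_phi_quasi_module Y YW sigma (fun k : int => q ^ k).

(** Partial fractions with poles at the [q ^ k]. The coefficients of [z^-1] and [z^-2] in
    [Y(sigma k u, z) v] are the modes 0 and 1; the list [ks] contains every [k] where one of them is
    nonzero. *)
Lemma commutator_formula (ks : seq int) u v w (N m : int) : uniq ks ->
    (forall k n, 2 <= n -> Y (sigma k u) n v = 0) ->
    (forall k, k \notin ks -> Y (sigma k u) 0 v = 0 /\ Y (sigma k u) 1 v = 0) ->
  YW u (YW v w (N - m)) m - YW v (YW u w m) (N - m) =
    \sum_(k <- ks) (q ^ k)^-1 ^ m *:
      (YW (Y (sigma k u) 0 v) w N - m%:~R *: YW (Y (sigma k u) 1 v) w N).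
Proof.
move=> uks Y2 ks0; have [phi equiv /(_ u v) [P1 [P10 rP1 P1c]]] := module.
have [P [P0 PaPb]] := quasi_locality phi u v w N.
apply: (@partial_fractions _ _ q ks (homog YW u v w N)
  (fun m => YW v (YW u w m) (N - m)) P P1 (fun k => YW (Y (sigma k u) 0 v) w N)
  (fun k => YW (Y (sigma k u) 1 v) w N)) => //.
- exact: (homog_bounded_above phi).
- have [_ _ /(_ u w)[M uM] _ _] := phi; exists M => l lM.
  by rewrite uM // (YW0r phi).
- exact: quasi_compatible_fin.
- by move=> k /ks0[-> ->]; rewrite !(YW0l phi).
move=> k; have [p [p0 /(_ w N) ep]] := module_expands phi (sigma k u) v.
(* By equivariance, rescaling [x1] by [q ^ k] replaces [u] by [sigma k u] and moves the pole from
   [q ^ k] to 1. *)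
have -> : twist (q ^ k) (homog YW u v w N) = homog YW (sigma k u) v w N.
  by apply/funext => l; rewrite /homog /YW2 equiv.
apply: (fin_seq_pole_polar _ _ p0 ep); first exact: (homog_bounded_above phi).
by move=> l l2; rewrite /iterate Y2 ?(YW0l phi) //; lia.
Qed.

End Commutator.

(** * Modules over a presented Lie algebra *)

Section LinearOperators.
Variables (K : fieldType) (W : lmodType K).

Definition linop_pred : {pred W -> W} := fun f => `[< linear f >].

Fact linop_submod : subsemimod_closed linop_pred.
Proof.
split; first split.
- by apply/asboolP => c x y; rewrite -[RHS]/(c *: (0 : W) + 0) scaler0 addr0.
- move=> f g /asboolP lf /asboolP lg; apply/asboolP => c x y.
  by rewrite -![(f + g) _]/(f _ + g _) lf lg scalerDr addrACA.
- move=> d f /asboolP lf; apply/asboolP => c x y.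
  by rewrite -![(d *: f) _]/(d *: f _) lf scalerDr !scalerA mulrC.
Qed.

(** Endomorphisms are packaged as an [lmodType] because [eval] and [lift] take their values in
    one. *)
Record linop := Linop {linop_fun :> W -> W; _ : linop_fun \in linop_pred}.
HB.instance Definition _ := [isSub for linop_fun].
HB.instance Definition _ := [Choice of linop by <:].
HB.instance Definition _ :=
  GRing.SubChoice_isSubLmodule.Build K (W -> W) linop_pred linop linop_submod.

Lemma linopP (f : linop) : linear f.
Proof. by apply/asboolP; exact: (valP f). Qed.

Lemma linop_eq (f g : linop) : (forall w, f w = g w) -> f = g.
Proof. by move=> fg; apply/val_inj/funext. Qed.

Definition linop_of (f : W -> W) (lf : linear f) : linop := Linop (introT (asboolP _) lf).

Lemma linop_ofE f lf w : @linop_of f lf w = f w. Proof. by []. Qed.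

Lemma linopDE (f g : linop) w : (f + g) w = f w + g w. Proof. by []. Qed.
Lemma linopZE c (f : linop) w : (c *: f) w = c *: f w. Proof. by []. Qed.
Lemma linop0E w : (0 : linop) w = 0. Proof. by []. Qed.

Lemma linopDr (f : linop) x y : f (x + y) = f x + f y.
Proof. exact/linear_mapD/linopP. Qed.

Lemma linopZr (f : linop) c x : f (c *: x) = c *: f x.
Proof. exact/linear_mapZ/linopP. Qed.

Lemma linopNr (f : linop) x : f (- x) = - f x.
Proof. exact/linear_mapN/linopP. Qed.

Fact linop_lie_subproof (f g : linop) : linear (fun w => f (g w) - g (f w)).
Proof.
move=> c x y; rewrite !linopDr !linopZr scalerBr opprD.
by rewrite addrACA.
Qed.

Definition linop_lie (f g : linop) : linop := linop_of (linop_lie_subproof f g).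

Lemma linop_lie_linearl (g : linop) : linear (linop_lie^~ g).
Proof.
move=> c f f'; apply: linop_eq => w; rewrite !(linopDE, linopZE, linop_ofE).
by rewrite linopDr linopZr scalerBr opprD addrACA.
Qed.

Lemma linop_lie_linearr (f : linop) : linear (linop_lie f).
Proof.
move=> c g g'; apply: linop_eq => w; rewrite !(linopDE, linopZE, linop_ofE).
by rewrite linopDr linopZr scalerBr opprD addrACA.
Qed.

Lemma linop_liexx (f : linop) : linop_lie f f = 0.
Proof. by apply: linop_eq => w; rewrite linop_ofE subrr. Qed.

Lemma linop_lie_jacobi (f g h : linop) :
  linop_lie f (linop_lie g h) + linop_lie g (linop_lie h f)
  + linop_lie h (linop_lie f g) = 0.
Proof.
apply: linop_eq => w; rewrite !(linopDE, linop0E, linop_ofE) !(linopDr, linopNr).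
rewrite !opprB.
have abel (A B C D E G : W) :
    A - B + (C - D) + (D - E + (B - G)) + (G - C + (E - A)) = 0.
  rewrite [D - E + _]addrC [X in X + _](addrACA (A - B)) !subrKA.
  by rewrite (addrACA (A - G)) !subrKA subrr.
exact: abel.
Qed.

Variables (X : Type) (rel : term K unit X -> term K unit X -> Prop) (f : X -> linop).
Hypothesis f_rel : forall s t, rel s t ->
  eval (fun=> linop_lie) f s = eval (fun=> linop_lie) f t.

(** Commutators already satisfy the Lie axioms, so only the given relations have to be checked on
    generators. *)
Fact lie_pres_eval s t : lie_rel rel s t ->
  eval (fun=> linop_lie) f s = eval (fun=> linop_lie) f t.
Proof.
case=> {s t} [s t /f_rel//|t|s t u] /=; first exact: linop_liexx.
exact: linop_lie_jacobi.
Qed.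

Definition lie_pres_act (x : lie_pres rel) : linop := Defs.lift (fun=> linop_lie) f x.

Definition lie_pres_module : lie_module (lie_pres rel) W.
Proof.
refine (@LieModule _ _ _ (fun x w => lie_pres_act x w) _ _ _).
- move=> w c x y /=.
  by rewrite /lie_pres_act (lift_linear (fun=> linop_lie_linearl)
    (fun=> linop_lie_linearr) lie_pres_eval).
- by move=> x; exact: linopP.
- move=> x y w /=.
  by rewrite /lie_pres_act (lift_op (fun=> linop_lie_linearl)
    (fun=> linop_lie_linearr) lie_pres_eval tt).
Defined.

Lemma lie_pres_module_gen (x : X) w : lie_pres_module (gen x) w = f x w.
Proof.
by rewrite /= /lie_pres_act (lift_gen (fun=> linop_lie_linearl)
  (fun=> linop_lie_linearr) lie_pres_eval).
Qed.

End LinearOperators.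

(** * Nonnegative products of generators in the affine vertex algebra *)

Section VacuumModes.
Variables (K : numFieldType) (L : lieAlgType K) (F : inv_form L) (ell : K).
Variables (Y : vertex_algebra (vacuum_module F ell)) (Y_affine : affine_va_structure Y).
Implicit Types (a b : L).

Lemma vacuum_act_nonneg (x : affine F) :
  affine_nonneg x -> vacuum_act x (vacuum F ell) = (ell * x.2) *: vacuum F ell.
Proof.
move=> x0; rewrite /vacuum_act /vacuum ind_act_tensor mulr1 -[env_inj x]mul1r.
rewrite tensor_balanced // /level_act.
exact: (linear_mapZ (ell * x.2) (1 : K^o) (tensor_linearr _ _ 1)).
Qed.

Lemma vacuum_act_loop a (n : int) : 0 <= n -> vacuum_act (loop a n) (vacuum F ell) = 0.
Proof.
move=> n0; rewrite vacuum_act_nonneg /= ?mulr0 ?scale0r // => m m0.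
by rewrite -[LHS]/(if m == n then a else 0) ifF //; lia.
Qed.

(** As [a_n] kills the vacuum, [a_n b_(-1) 1 = [a_n, b_(-1)] 1]. For [n > 0] the loop part of the
    bracket has degree [n - 1 >= 0] and also kills the vacuum, leaving the central term. *)
Lemma vacuum_mode a b (n : int) : 0 <= n ->
  Y (vacuum_inj a) n (vacuum_inj b) =
    if n == 0 then vacuum_inj (lie a b)
    else if n == 1 then (ell * F a b) *: vac Y else 0.
Proof.
move=> n0; have [-> modes] := Y_affine; rewrite modes.
have act0 x : vacuum_act x 0 = 0 :> vacuum_module F ell by exact: ind_act0.
have act_lie x y (v : vacuum_module F ell) : vacuum_act (lie x y) v =
    vacuum_act x (vacuum_act y v) - vacuum_act y (vacuum_act x v) by exact: ind_act_lie.
rewrite /vacuum_inj -[LHS]subr0 -[X in _ - X](act0 (loop b (- 1))).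
rewrite -[X in _ - vacuum_act _ X](vacuum_act_loop a n0) -act_lie.
have -> : lie (loop a n : affine F) (loop b (- 1)) = loop_lie F n (- 1) a b.
  exact: affine_lie_loop.
have [->|n_neq0] := eqVneq n 0.
  by congr vacuum_act; rewrite /loop_lie /loop add0r.
have nonneg : forall m : int, m < 0 -> (loop_lie F n (- 1) a b).1 m = 0.
  by move=> m m0; rewrite -[LHS]/(if m == n - 1 then lie a b else 0) ifF //; lia.
rewrite vacuum_act_nonneg //= subr_eq0.
by case: eqP => [->|]; rewrite ?mulr1z ?mul1r // mulr0 scale0r.
Qed.

End VacuumModes.

Section FrakDRelations.
Variable K : numFieldType.

Lemma dgen_lie (a r b s : int) : lie (dgen a r) (dgen b s) =
  (a + b == s - r)%:R *: dgen (a + b) (- a + s)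
  - (a + b == r - s)%:R *: dgen (a + b) (a + s)
  - (a - b == s - r)%:R *: dgen (a - b) (- a + s)
  + (a - b == r - s)%:R *: dgen (a - b) (a + s) :> frakD K.
Proof.
have := pres_rel (lie_rel_base (frakD_lie K a r b s)).
by rewrite pi_op !(piD, piB, piZ).
Qed.

Lemma dgenN (a r : int) : dgen (- a) r = - dgen a r :> frakD K.
Proof. by have := pres_rel (lie_rel_base (frakD_opp K a r)); rewrite piN. Qed.

End FrakDRelations.

(** * The q-Virasoro relations *)

Section QVirasoroModule.
Variables (K : numClosedFieldType) (q ell : K).
Hypothesis q_neq0 : q != 0.
Hypothesis q_nonroot : forall n : nat, (0 < n)%N -> q ^+ n != 1.
Variables (Y : vertex_algebra (VfrakD ell)) (Y_affine : affine_va_structure Y).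
Variable sigma : int -> VfrakD ell -> VfrakD ell.
Hypothesis sigma_d : forall m a r : int,
  sigma m (vacuum_inj (dgen a r)) = vacuum_inj (dgen a (r + m)).
Variables (W : lmodType K) (YW : VfrakD ell -> W -> int -> W).
Hypothesis module : equivariant_phi_quasi_module Y YW sigma (fun m : int => q ^ m).

Local Notation X a n w := (YW (vacuum_inj (dgen a 0)) w n).

Lemma expq_neq1 (a : int) : a != 0 -> q ^ a != 1.
Proof.
move=> a0; have := @q_nonroot (absz a); rewrite exprnP; case: a a0 => n n0.
  by move=> /= h; apply: h; lia.
rewrite NegzE /= => /(_ isT) h; apply: contra h.
by rewrite -invr_expz invr_eq1.
Qed.

Lemma expq_eq1 (a : int) : (q ^ a == 1) = (a == 0).
Proof.
by have [->|/expq_neq1/negPf] := eqVneq a 0; rewrite ?expr0z ?eqxx.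
Qed.

Lemma qint_num (x : int) : (q - q^-1) * qint q x = q ^ x - q ^ (- x).
Proof.
have q1 : q != 1 by have := @q_nonroot 1; rewrite expr1; exact.
have q2 : q ^+ 2 != 1 by exact: q_nonroot.
rewrite /qint (negPf q1).
have d0 : q^-1 - q != 0.
  apply: contra q2; rewrite subr_eq0 => /eqP e.
  by rewrite expr2 -{1}e mulVf.
by rewrite mulrC -mulrA -[q - _]opprB mulrN mulVf // mulrN1 opprB.
Qed.

(** Since [d^{c,s}] is the image of [d^{c,0}] under [sigma s], equivariance reduces everything to
    second index 0. *)
Lemma YW_dgen (c s N : int) (w : W) :
  YW (vacuum_inj (dgen c s)) w N = (q ^ s) ^ N *: X c N w.
Proof. by have [_ equiv _] := module; rewrite -equiv sigma_d add0r. Qed.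

Lemma sum_indic (ks : seq int) (j : int) (G : int -> W) : uniq ks -> j \in ks ->
  \sum_(k <- ks) (k == j)%:R *: G k = G j.
Proof.
move=> uks jks; rewrite (bigD1_seq j) //= eqxx scale1r big1 ?addr0 // => i /negPf ->.
by rewrite scale0r.
Qed.

Lemma vacuum_inj_linear : linear (fun x : frakD K => vacuum_inj x : VfrakD ell).
Proof.
move=> c x y; rewrite /vacuum_inj /vacuum_act.
have -> : loop (c *: x + y) (- 1) =
    c *: (loop x (- 1) : affine (frakD_form K)) + loop y (- 1).
  by congr pair; rewrite /= ?mono_linear // scaler0 addr0.
exact: ind_act_linearl.
Qed.

Lemma YW_inj_linear (w : W) N : linear (fun x : frakD K => YW (vacuum_inj x) w N).
Proof.
have [[lin _ _ _ _] _ _] := module => c x y.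
by rewrite vacuum_inj_linear lin.
Qed.

(** The commutator formula for [d^{a,0}] and [d^{b,0}]: each of the four terms of the bracket of
    [d^{a,k}] with [d^{b,0}] selects one [k], and the form selects [k = 0]. *)
Lemma commutator_X a b (m N : int) (w : W) :
  X a m (X b (N - m) w) - X b (N - m) (X a m w) =
    (q ^ (a * (m - N) + b * m) - q ^ (- (a * (m - N) + b * m))) *: X (a + b) N w
    - (q ^ (a * (m - N) - b * m) - q ^ (- (a * (m - N) - b * m))) *: X (a - b) N w
    - (m%:~R * ell * ((a - b == 0)%:R - (a + b == 0)%:R) * (N == 0)%:R) *: w.
Proof.
(* These values may coincide; removing duplicates while keeping the Kronecker deltas counts each
   term once in every case. *)
pose ks := undup [:: 0; a + b; - (a + b); a - b; - (a - b)].
have uks : uniq ks by exact: undup_uniq.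
pose phi (x : frakD K) := YW (vacuum_inj x) w N.
have lphi : linear phi by exact: YW_inj_linear.
have phiD x y : phi (x + y) = phi x + phi y by exact: linear_mapD.
have phiZ c x : phi (c *: x) = c *: phi x by exact: linear_mapZ.
have phiN x : phi (- x) = - phi x by exact: linear_mapN.
have sig k : sigma k (vacuum_inj (dgen a 0)) = vacuum_inj (dgen a k).
  by rewrite sigma_d add0r.
have mode0 k : Y (sigma k (vacuum_inj (dgen a 0))) 0 (vacuum_inj (dgen b 0)) =
    vacuum_inj (lie (dgen a k) (dgen b 0)) by rewrite sig vacuum_mode.
have mode1 k : Y (sigma k (vacuum_inj (dgen a 0))) 1 (vacuum_inj (dgen b 0)) =
    (ell * ((k == 0)%:R * ((a - b == 0)%:R - (a + b == 0)%:R))) *: vac Y.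
  by rewrite sig vacuum_mode // -frakD_formE.
have lieE k : lie (dgen a k) (dgen b 0) =
    (k == - (a + b))%:R *: dgen (a + b) (- a)
  - (k == a + b)%:R *: dgen (a + b) a
  - (k == - (a - b))%:R *: dgen (a - b) (- a)
  + (k == a - b)%:R *: dgen (a - b) a :> frakD K.
  rewrite dgen_lie !addr0.
  have -> : (a + b == 0 - k) = (k == - (a + b)) by lia.
  have -> : (a - b == 0 - k) = (k == - (a - b)) by lia.
  by rewrite [a + b == k]eq_sym [a - b == k]eq_sym.
rewrite (@commutator_formula _ _ _ _ _ q sigma q_neq0 q_nonroot module ks) //; last 2 first.
- by move=> k n n2; rewrite sig vacuum_mode ?ifF ?ifF //; lia.
- move=> k; rewrite mem_undup !inE !negb_or.
  case/and5P=> /negPf k0 /negPf k1 /negPf k2 /negPf k3 /negPf k4.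
  rewrite mode0 mode1 lieE k1 k2 k3 k4 !scale0r !subr0 addr0 k0 mul0r mulr0 scale0r.
  by split=> //; exact: linear_map0 vacuum_inj_linear.
have YWvac c : YW (c *: vac Y) w N = (c * (N == 0)%:R) *: w.
  have [[lin _ _ YWv _] _ _] := module.
  by rewrite (linear_mapZ _ _ (lin w N)) YWv; case: eqP; rewrite ?mulr1 // mulr0 scale0r scaler0.
pose G c s k : W := (q ^ k)^-1 ^ m *: phi (dgen c s).
under eq_bigr => k _.
  rewrite mode0 mode1 -/(phi _) lieE YWvac !(phiD, phiN, phiZ).
  rewrite scalerBr !(scalerDr, scalerN) !scalerA ![(q ^ k)^-1 ^ m * _%:R]mulrC -!scalerA.
  over.
rewrite sumrB big_split /= sumrB sumrB.
rewrite (sum_indic (G (a + b) (- a))) // ?mem_undup ?inE ?eqxx ?orbT //.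
rewrite (sum_indic (G (a + b) a)) // ?mem_undup ?inE ?eqxx ?orbT //.
rewrite (sum_indic (G (a - b) (- a))) // ?mem_undup ?inE ?eqxx ?orbT //.
rewrite (sum_indic (G (a - b) a)) // ?mem_undup ?inE ?eqxx ?orbT //.
have GE c s k : G c s k = q ^ (s * N - k * m) *: X c N w.
  rewrite /G /phi YW_dgen scalerA; congr (_ *: _).
  by rewrite invr_expz !exprz_exp -expfzDr //; congr (q ^ _); ring.
under eq_bigr => k _ do rewrite !scalerA [_ * (k == 0)%:R]mulrC -!mulrA -scalerA.
rewrite (sum_indic (fun k => (_ * _) *: w)) // ?mem_undup ?inE ?eqxx //.
rewrite expr0z invr1 exp1rz mul1r !mulrA; congr (_ - _); rewrite !GE.
have -> : - a * N - - (a + b) * m = a * (m - N) + b * m by ring.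
have -> : a * N - (a + b) * m = - (a * (m - N) + b * m) by ring.
have -> : - a * N - - (a - b) * m = a * (m - N) - b * m by ring.
have -> : a * N - (a - b) * m = - (a * (m - N) - b * m) by ring.
move: (a * (m - N) + b * m) (a * (m - N) - b * m) => e f.
by rewrite !scalerBl opprB addrA addrAC.
Qed.

(** The scalar obtained by solving the definition of the hatted series for [D^a(n)]: it is what must
    be added to the coefficient of [x^(- n)] in [Y_W(d^{a,0}, x)]. *)
Definition kappa (a n : int) : K :=
  if (a != 0) && (n == 0) then ell / (q ^ (- a) - q ^ a) else 0.

Lemma qvir_op_subproof (g : qvir_gen) : linear (fun w : W =>
  match g with
  | QVc => ell *: w
  | QVD a n => X a (- n) w + kappa a n *: w
  end).
Proof.
move=> c x y; case: g => [|a n]; first by rewrite scalerDr !scalerA mulrC.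
have [[_ lin _ _ _] _ _] := module.
rewrite lin scalerDr !scalerA [kappa a n * c]mulrC -scalerA addrACA.
by rewrite -scalerDr.
Qed.

Definition qvir_op (g : qvir_gen) : linop W := linop_of (qvir_op_subproof g).

Lemma XN a n w : X (- a) n w = - X a n w.
Proof. by rewrite dgenN (linear_mapN _ (YW_inj_linear w n)). Qed.

Lemma kappaN a n : kappa (- a) n = - kappa a n.
Proof.
rewrite /kappa oppr_eq0 opprK; case: ifP => _; last by rewrite oppr0.
by rewrite -[q ^ a - _]opprB invrN mulrN.
Qed.

Lemma XZr a n c w : X a n (c *: w) = c *: X a n w.
Proof.
by have [[_ lin _ _ _] _ _] := module; exact: linear_mapZ (lin _ n).
Qed.

Lemma XDr a n x y : X a n (x + y) = X a n x + X a n y.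
Proof.
by have [[_ lin _ _ _] _ _] := module; exact: linear_mapD (lin _ n).
Qed.

(** The contribution to the scalar part of the index [c], later [a + b] or [a - b]. For [c] nonzero
    the shift [kappa] cancels the [q]-integer exactly; for [c = 0] the shift is 0 and [[m]_1 = m]
    gives the level term of the affine algebra. *)
Lemma central_term (c n m e : int) : (m + n = 0 -> e = - (c * n)) ->
  (q ^ e - q ^ (- e)) * kappa c (m + n) + qint (q ^ c) m * (m + n == 0)%:R * ell
  = - (n%:~R * ell * (c == 0)%:R * (m + n == 0)%:R).
Proof.
move=> def_e; rewrite /kappa /qint expq_eq1 invr_expz.
have [mn|_] := eqVneq (m + n) 0; last first.
  by rewrite andbF !mulr0 mul0r addr0 oppr0.
rewrite (def_e mn); have -> : m = - n by lia.
rewrite andbT /=; have [->|c0] := eqVneq c 0.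
  by rewrite mulr0 !mulr1 mulrNz mulNr add0r.
rewrite /= !mulr1 mulr0 oppr0 !exprz_exp !opprK mulrN.
by set d := (_ - _)^-1; ring.
Qed.

Lemma qvir_op_rel s t : qvir_rel q s t ->
  eval (fun=> @linop_lie _ W) qvir_op s = eval (fun=> @linop_lie _ W) qvir_op t.
Proof.
case=> {s t} [t|a n|a n b m] /=; apply: linop_eq => w.
- by rewrite linop_ofE /= linopZr subrr.
- by rewrite linopZE scaleN1r /= XN kappaN opprD scaleNr.
rewrite !(linopDE, linopZE) /=.
(* The shifts are scalars, so they drop out of the commutator on the left. *)
have cancel (A B U S Z : W) : A + U + (S + Z) - (B + S + (U + Z)) = A - B.
  by rewrite -(addrA A U) -(addrA B S) (addrCA S U Z) [B + _]addrC addrKA.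
rewrite !XDr !XZr !(scalerDr, scalerA) [kappa b m * _]mulrC cancel.
(* The mode [n] sits at the power [- n] of [x], so the total degree is [- (m + n)]. *)
have := commutator_X a b (- n) (- (m + n)) w.
have -> : - (m + n) - - n = - m by lia.
have -> : - n - - (m + n) = m by lia.
rewrite !mulrN oppr_eq0 => ->.
rewrite !qint_num !mulN1r !scaleNr opprK.
rewrite [in RHS]addrACA -[RHS]addrA; congr (_ + _).
rewrite -!scalerDl -scaleNr; congr (_ *: w).
(* The scalar part is grouped by the indices [a + b] and [a - b], each of the form treated in
   [central_term]. *)
transitivity ((q ^ (a * m - b * n) - q ^ (- (a * m - b * n))) * kappa (a + b) (m + n) +
    qint (q ^ (a + b)) m * (m + n == 0)%:R * ell -
  ((q ^ (a * m + b * n) - q ^ (- (a * m + b * n))) * kappa (a - b) (m + n) +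
    qint (q ^ (a - b)) m * (m + n == 0)%:R * ell)); last by ring.
rewrite !central_term; first by rewrite mulrNz; ring.
- by move=> mn; rewrite (_ : m = - n); [ring | lia].
- by move=> mn; rewrite (_ : m = - n); [ring | lia].
Qed.

Theorem qvirasoro_module : exists rho : lie_module (qvir q) W,
    [/\ restricted rho, of_level rho ell &
        forall (a r n : int) (w : W),
          hatDr rho a r n w = YW (vacuum_inj (dgen a r)) w n].
Proof.
pose rho : lie_module (qvir q) W := lie_pres_module qvir_op_rel.
have rhoD a n w : rho (qvirD q a n) w = X a (- n) w + kappa a n *: w.
  exact: lie_pres_module_gen.
have rhoc w : rho (qvirc q) w = ell *: w by exact: lie_pres_module_gen.
exists rho; split=> [a w|//|a r n w].
  have [[_ _ /(_ (vacuum_inj (dgen a 0)) w)[N XN0] _ _] _ _] := module.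
  (* The extra 1 forces [n] to be nonzero, where the shift [kappa] vanishes. *)
  exists (absz N + 1)%N => n nN; rewrite rhoD XN0; last by lia.
  by rewrite /kappa ifF ?scale0r ?addr0 //; apply/negbTE; rewrite negb_and; lia.
rewrite [RHS]YW_dgen /hatDr /hatD rhoD rhoc opprK; congr (_ *: _).
rewrite /kappa oppr_eq0; case: ifP => _; last by rewrite scale0r subr0 addr0.
by rewrite scalerA mulrC addrK.
Qed.

End QVirasoroModule.

Theorem theorem3p8 (R : realType) (q ell : R[i]) (q_neq0 : q != 0)
    (q_nonroot : forall n : nat, (0 < n)%N -> q ^+ n != 1)
    (Y : vertex_algebra (VfrakD ell)) (Y_affine : affine_va_structure Y)
    (sigma : int -> VfrakD ell -> VfrakD ell)
    (sigma_aut : forall m : int, va_automorphism Y (sigma m))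
    (sigma_d : forall m a r : int,
      sigma m (vacuum_inj (dgen a r)) = vacuum_inj (dgen a (r + m)))
    (W : lmodType R[i]) (YW : VfrakD ell -> W -> int -> W)
    (W_module : equivariant_phi_quasi_module Y YW sigma (fun m : int => q ^ m)) :
  exists rho : lie_module (qvir q) W,
    [/\ restricted rho, of_level rho ell &
        forall (a r n : int) (w : W),
          hatDr rho a r n w = YW (vacuum_inj (dgen a r)) w n].
Proof.
exact: (qvirasoro_module q_neq0 q_nonroot Y_affine sigma_d W_module).
Qed.
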